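(* Let $U\subseteq\mathbb{R}^n$ be open and let $L:U\times\mathbb{R}^n\to\mathbb{R}$, $(q,\dot q)\mapsto L(q,\dot q)$, be a smooth Lagrangian whose Hessian $\frac{\partial^2 L}{\partial\dot q\partial\dot q}(q,\dot q)$ is invertible everywhere. For a smooth function $K(q,\dot q)$ put $$\theta_2(K)=\frac18\frac{\partial K}{\partial q}\ddot q+\frac1{24}\frac{\partial K}{\partial\dot q}q^{(3)},$$ $$\theta_4(K)=\frac{1}{384}\frac{\partial K}{\partial q}q^{(4)}+\frac1{1920}\frac{\partial K}{\partial\dot q}q^{(5)}+\frac1{128}\ddot q^{T}\frac{\partial^2K}{\partial q\partial q}\ddot q+\frac1{1152}(q^{(3)})^{T}\frac{\partial^2K}{\partial\dot q\partial\dot q}q^{(3)}+\frac1{192}(q^{(3)})^{T}\frac{\partial^2K}{\partial q\partial\dot q}\ddot q,$$ $$\Phi_2(K)=\theta_2(K)-\frac1{24}\frac{d^2K}{dt^2},\qquad \Phi_4(K)=\theta_4(K)+\frac{7}{5760}\frac{d^4K}{dt^4},$$ where $\frac{d}{dt}$ is the total time derivative, and where in each of these expressions, and in $\frac{d^2}{dt^2}\theta_2(K)$, all of $\ddot q,q^{(3)},q^{(4)},\dots$ are finally replaced by the functions of $(q,\dot q)$ obtained from the Euler--Lagrange equation $\ddot q=\big(\frac{\partial^2 L}{\partial\dot q\partial\dot q}\big)^{-1}\big(\frac{\partial L}{\partial q}-\frac{\partial^2 L}{\partial q\partial\dot q}\dot q\big)$ of $L$ and its total time derivatives, so that each is again a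 function of $(q,\dot q)$. Define the fourth order surrogate Lagrangian $$\hat L^{(4)}=L-h^2\Phi_2(L)-h^4\Phi_4(L)+h^4\Phi_2(\Phi_2(L))+\frac{h^4}{24}\frac{d^2}{dt^2}\theta_2(L).$$ Let $\hat L^{(4)}_{\mathrm m}$ be the modified Lagrangian of $\hat L^{(4)}$ for the midpoint variational integrator (see context). Then, as formal power series in $h$, $$\hat L^{(4)}_{\mathrm m}(q,\dot q)=L(q,\dot q)+O(h^6),$$ and consequently the Euler--Lagrange equation of $\hat L^{(4)}_{\mathrm m}$, solved for $\ddot q$, agrees with that of $L$ up to $O(h^6)$.
   Context: Conventions: $\frac{\partial^2 K}{\partial q\partial\dot q}$ is the matrix with $(i,j)$ entry $\frac{\partial^2 K}{\partial\dot q_i\partial q_j}$; $\frac{\partial K}{\partial q}w$ denotes $\sum_i\frac{\partial K}{\partial q_i}w_i$, and similarly for $\frac{\partial K}{\partial\dot q}w$. For formal power series in $h$ whose coefficients are smooth functions on $U\times\mathbb{R}^n$, $A=B+O(h^k)$ means that the coefficients of $h^0,\dots,h^{k-1}$ in $A$ and $B$ coincide. Midpoint variational integrator: for a Lagrangian $\Lambda$ and time step $h$ the discrete Lagrangian is $\Lambda_{\mathrm d}(q_k,q_{k+1})=h\,\Lambda\big(\frac{q_k+q_{k+1}}{2},\frac{q_{k+1}-q_k}{h}\big)$, and the integrator is given by the discrete Euler--Lagrange equations $D_1\Lambda_{\mathrm d}(q_k,q_{k+1})+D_2\Lambda_{\mathrm d}(q_{k-1},q_k)=0$. Modified Lagrangian: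 it is a Lagrangian $\Lambda_{\mathrm m}$ such that (formally in $h$) $\Lambda_{\mathrm d}(q_k,q_{k+1})=\int_{t_k}^{t_{k+1}}\Lambda_{\mathrm m}\,dt$, $h=t_{k+1}-t_k$, where $q_k=q(t_k)$, $q_{k+1}=q(t_{k+1})$ and $q$ is a solution of the Euler--Lagrange equation of $\Lambda_{\mathrm m}$. Precisely, let $\Lambda=\sum_{i\ge0}h^{2i}\Lambda_i(q,\dot q)$ be a (possibly finite) formal power series in $h^2$ with smooth coefficients and with $\frac{\partial^2\Lambda_0}{\partial\dot q\partial\dot q}$ invertible. Put $$\mathcal{M}=\Lambda\Big(\sum_{j\ge0}\frac{h^{2j}}{2^{2j}(2j)!}q^{(2j)},\ \sum_{j\ge0}\frac{h^{2j}}{2^{2j}(2j+1)!}q^{(2j+1)}\Big),$$ Taylor expanded in $h$ about $(q,\dot q)$ (this is the Taylor expansion of $\Lambda_{\mathrm d}/h$ about the midpoint in time), and $$\Lambda_{\mathrm{jet}}=\sum_{i\ge0}h^{2i}(2^{1-2i}-1)\frac{B_{2i}}{(2i)!}\frac{d^{2i}}{dt^{2i}}\mathcal{M},$$ with $B_{2i}$ the Bernoulli numbers and $\frac{d}{dt}$ the total time derivative; its coefficients are functions of $q,\dot q,\ddot q,q^{(3)},\dots$. The modified Lagrangian $\Lambda_{\mathrm m}=\sum_{i\ge0}h^{2i}\Lambda_{\mathrm m,i}(q,\dot q)$ is the unique formal power series that is obtained from $\Lambda_{\mathrm{jet}}$ by eliminating $\ddot q,q^{(3)},\dots$ by means of the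 Euler--Lagrange equation $\ddot q=\big(\frac{\partial^2\Lambda_{\mathrm m}}{\partial\dot q\partial\dot q}\big)^{-1}\big(\frac{\partial\Lambda_{\mathrm m}}{\partial q}-\frac{\partial^2\Lambda_{\mathrm m}}{\partial q\partial\dot q}\dot q\big)$ of $\Lambda_{\mathrm m}$ itself and its successive total time derivatives (this determines the coefficients recursively in powers of $h^2$, starting from $\Lambda_{\mathrm m,0}=\Lambda_0$). *)

(* Defs.v *)
From HB Require Import structures.
From mathcomp Require Import all_boot all_order all_algebra.
From mathcomp Require Import all_classical all_reals.
From mathcomp Require Import topology normedtype derive.

Set Implicit Arguments.
Unset Strict Implicit.
Unset Printing Implicit Defensive.
Import Order.TTheory GRing.Theory Num.Theory.
Import numFieldNormedType.Exports.

Local Open Scope classical_set_scope.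
Local Open Scope ring_scope.

(* Course-of-values recursion: [step k f] may only consult [f] below [k]. *)
Fixpoint srec_fuel {A : Type} (d : A) (step : nat -> (nat -> A) -> A)
    (fuel k : nat) : A :=
  if fuel is fuel'.+1 then step k (srec_fuel d step fuel') else d.

Definition srec {A : Type} (d : A) (step : nat -> (nat -> A) -> A) (k : nat) :=
  srec_fuel d step k.+1 k.

Lemma srecE {A : Type} (d : A) (step : nat -> (nat -> A) -> A) :
  (forall k f g, (forall i, (i < k)%N -> f i = g i) -> step k f = step k g) ->
  forall k, srec d step k = step k (srec d step).
Proof.
move=> ext; suff fuelE : forall n m k, (k < n)%N -> (k < m)%N ->
    srec_fuel d step n k = srec_fuel d step m k.
  by move=> k; apply: ext => i ik; apply: fuelE.
elim=> // n IH [//|m] k kn km /=; apply: ext => i ik.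
by apply: IH; apply: leq_trans ik _.
Qed.

(* To be unfolded with [srecE] only: conversion would unroll the recursion. *)
#[global] Opaque srec.

(* Bernoulli numbers: B_0 = 1 and sum_(k <= m) C(m+1, k) B_k = 0 for m > 0. *)
Definition bernoulli {R : numFieldType} : nat -> R :=
  srec 0 (fun m B =>
    (m == 0%N)%:R - m.+1%:R^-1 * \sum_(k < m) 'C(m.+1, k)%:R * B k).

Lemma bernoulli_sum (R : numFieldType) (m : nat) :
  \sum_(k < m.+1) 'C(m.+1, k)%:R * bernoulli k = (m == 0%N)%:R :> R.
Proof.
rewrite big_ord_recr /= [bernoulli m]srecE; last first.
  by move=> k f g fg; under eq_bigr do rewrite fg//.
rewrite binSn mulrBr mulrA divff ?pnatr_eq0// mul1r addrC subrK.
by case: m => [|m]; rewrite ?mulr1 ?mulr0.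
Qed.

(* Inverse of the formal power series of matrices \sum_k H_k X^k. *)
Definition series_invmx {R : comUnitRingType} {n : nat}
    (H : nat -> 'M[R]_n) : nat -> 'M[R]_n :=
  srec 0 (fun k G => if k == 0%N then invmx (H 0%N)
    else - (invmx (H 0%N) *m \sum_(i < k) H (k - i)%N *m G i)).

Lemma series_invmxE (R : comUnitRingType) (n : nat) (H : nat -> 'M[R]_n) k :
  series_invmx H k = if k == 0%N then invmx (H 0%N)
    else - (invmx (H 0%N) *m \sum_(i < k) H (k - i)%N *m series_invmx H i).
Proof.
rewrite [LHS]srecE// => {}k f g fg; case: eqP => // _.
by under eq_bigr do rewrite fg//.
Qed.

Lemma eq_series_invmx (R : comUnitRingType) (n : nat) (H H' : nat -> 'M[R]_n) k :
  (forall i, (i <= k)%N -> H i = H' i) -> series_invmx H k = series_invmx H' k.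
Proof.
elim/ltn_ind: k => k IH HH'; rewrite (series_invmxE H) (series_invmxE H').
rewrite (HH' 0%N (leq0n k)); case: eqP => [//|_].
apply: (f_equal (fun M => - (_ *m M))); apply: eq_bigr => i _.
rewrite (HH' _ (leq_subr i k)) (IH i (ltn_ord i))// => j ji.
by apply: HH'; apply: leq_trans ji _; exact: ltnW.
Qed.

Lemma series_mulmxV (R : comUnitRingType) (n : nat) (H : nat -> 'M[R]_n) k :
  H 0%N \in unitmx ->
  \sum_(i < k.+1) H (k - i)%N *m series_invmx H i = (k == 0%N)%:R%:M.
Proof.
move=> H0; rewrite big_ord_recr /= subnn [series_invmx H k]series_invmxE.
case: eqP => [->|_]; first by rewrite big_ord0 add0r mulmxV.
by rewrite mulmxN mulmxA mulmxV// mul1mx subrr raddf0.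
Qed.

(* C^infinity on an open set [A]: every iterated directional derivative
   (including [K] itself) is differentiable at every point of [A]. *)
Definition smooth_on {R : realType} {V : normedModType R} (A : set V)
    (K : V -> R) : Prop :=
  forall (vs : seq V) (x : V), A x ->
    differentiable (foldr (fun v F => 'D_v F) K vs) x.

(* Coefficient of X^m in the Taylor expansion of F(c_0 + c_1 X + c_2 X^2 + ...);
   the terms of degree > m of the formal curve do not contribute. *)
Definition taylor_coef {R : realType} {V : lmodType R}
    (F : V -> R) (c : nat -> V) (m : nat) : R :=
  derive1n m (fun s : R => F (\sum_(l < m.+1) s ^+ l *: c l)) 0 / m`!%:R.

Lemma eq_taylor_coef (R : realType) (V : lmodType R) (F : V -> R)
    (c c' : nat -> V) (m : nat) :
  (forall s : R, F (\sum_(l < m.+1) s ^+ l *: c l) =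
                 F (\sum_(l < m.+1) s ^+ l *: c' l)) ->
  taylor_coef F c m = taylor_coef F c' m.
Proof. by rewrite /taylor_coef => /funext ->. Qed.

(* The same for a formal power series \sum_i F_i X^i of functions. *)
Definition series_comp {R : realType} {V : lmodType R}
    (F : nat -> V -> R) (c : nat -> V) (m : nat) : R :=
  \sum_(i < m.+1) taylor_coef (F i) c (m - i).

Definition cst_series {T : Type} {V : nmodType} (F : T -> V) : nat -> T -> V :=
  fun i x => if i == 0%N then F x else 0.

(* All the series in this file are series in h^2: the i-th coefficient is that
   of h^(2 i), the odd powers of h being absent.  This is A = B + O(h^k), as
   series of functions on [S]. *)
Definition eq_bigO_h {T V : Type} (S : set T) (k : nat) (A B : nat -> T -> V) :
    Prop :=
  forall i x, (2 * i < k)%N -> S x -> A i x = B i x.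

Section Lagrangians.
Context {R : realType} {n : nat}.

(* (q, q') *)
Definition phase : Type := ('cV[R]_n * 'cV[R]_n)%type.

(* (q, q', q'', q^(3), ...) *)
Definition jet : Type := nat -> 'cV[R]_n.

Implicit Types (K L : phase -> R) (F : jet -> R) (Lam : nat -> phase -> R).

Definition partial_q (i : 'I_n) K : phase -> R := 'D_(delta_mx i 0, 0) K.
Definition partial_v (i : 'I_n) K : phase -> R := 'D_(0, delta_mx i 0) K.

Definition grad_q K (x : phase) : 'cV[R]_n := \col_i partial_q i K x.
Definition grad_v K (x : phase) : 'cV[R]_n := \col_i partial_v i K x.
Definition hess_qq K (x : phase) : 'M[R]_n :=
  \matrix_(i, j) partial_q i (partial_q j K) x.
Definition hess_vv K (x : phase) : 'M[R]_n :=
  \matrix_(i, j) partial_v i (partial_v j K) x.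
(* d^2 K / dq dq', with (i, j) entry d^2 K / dq'_i dq_j *)
Definition hess_qv K (x : phase) : 'M[R]_n :=
  \matrix_(i, j) partial_v i (partial_q j K) x.

Definition dotp (u v : 'cV[R]_n) : R := \sum_i u i 0 * v i 0.
Definition bilin (u : 'cV[R]_n) (A : 'M[R]_n) (v : 'cV[R]_n) : R :=
  (u^T *m A *m v) 0 0.

Definition on_jets K : jet -> R := fun x => K (x 0%N, x 1%N).

(* Total time derivative: the derivative of [F] along a curve with jet [x], i.e.
   in the direction (q', q'', q^(3), ...); see [total_dtE]. *)
Definition total_dt F : jet -> R :=
  fun x => derive1 (fun s : R => F (x + s *: (fun k => x k.+1))) 0.

(* If [F] only involves q, ..., q^(N-1), then
   dF/dt = \sum_(k < N) \sum_i (dF/dq^(k)_i) q^(k+1)_i. *)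
Lemma total_dtE (N : nat) (G : 'M[R]_(n, N) -> R) (x : jet) :
  let jetmx (y : jet) := \matrix_(i < n, k < N) y k i 0 in
  differentiable G (jetmx x) ->
  total_dt (fun y => G (jetmx y)) x =
    \sum_(i < n) \sum_(k < N) 'D_(delta_mx i k) G (jetmx x) * x k.+1 i 0.
Proof.
move=> jetmx dG; rewrite /total_dt.
set X := jetmx x; set Y := \matrix_(i < n, k < N) x k.+1 i 0.
have -> : (fun s : R => G (jetmx (x + s *: (fun k => x k.+1)))) =
    (fun s : R => G (s *: Y + X)).
  by apply/funext => s; congr G; apply/matrixP => i k; rewrite !mxE addrC.
have -> : derive1 (fun s : R => G (s *: Y + X)) 0 = 'D_Y G X.
  by rewrite /derive1 /derive; under eq_fun do rewrite addr0 scale0r add0r.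
rewrite deriveE// [Y]matrix_sum_delta linear_sum; apply: eq_bigr => i _.
rewrite linear_sum; apply: eq_bigr => k _.
by rewrite linearZ /= -deriveE// mxE mulrC.
Qed.

(* The Euler--Lagrange equation of [L] solved for q''. *)
Definition EL_field L (x : phase) : 'cV[R]_n :=
  invmx (hess_vv L x) *m (grad_q L x - hess_qv L x *m x.2).

(* Total time derivative of g(q, q'), followed by q'' := f(q, q'). *)
Definition dt_along (f g : phase -> 'cV[R]_n) (x : phase) : 'cV[R]_n :=
  'D_(x.2, 0) g x + 'D_(0, f x) g x.

(* q^(k) as a function of (q, q') on the solutions of q'' = f(q, q'). *)
Definition jet_along (f : phase -> 'cV[R]_n) (k : nat) (x : phase) :
    'cV[R]_n :=
  match k with
  | 0 => x.1
  | 1 => x.2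
  | j.+2 => iter j (dt_along f) f x
  end.

Definition reduce_EL L F : phase -> R :=
  fun x => F (fun k => jet_along (EL_field L) k x).

(* The same three notions when [Lam], [f] and [g] are formal power series. *)
Definition EL_series Lam (k : nat) (x : phase) : 'cV[R]_n :=
  \sum_(i < k.+1) series_invmx (fun j => hess_vv (Lam j) x) i *m
    (grad_q (Lam (k - i)%N) x - hess_qv (Lam (k - i)%N) x *m x.2).

Definition dt_along_series (f g : nat -> phase -> 'cV[R]_n)
    (m : nat) (x : phase) : 'cV[R]_n :=
  'D_(x.2, 0) (g m) x + \sum_(i < m.+1) 'D_(0, f i x) (g (m - i)%N) x.

Definition jet_along_series (f : nat -> phase -> 'cV[R]_n) (k : nat) :
    nat -> phase -> 'cV[R]_n :=
  match k with
  | 0 => cst_series (fun x => x.1)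
  | 1 => cst_series (fun x => x.2)
  | j.+2 => iter j (dt_along_series f) f
  end.

Definition reduce_EL_series Lam (F : nat -> jet -> R) : nat -> phase -> R :=
  fun m x => series_comp F (fun l k => jet_along_series (EL_series Lam) k l x) m.

Definition midpoint_curve (x : jet) (j : nat) : phase :=
  ((2 ^+ (2 * j) * (2 * j)`!%:R)^-1 *: x (2 * j)%N,
   (2 ^+ (2 * j) * (2 * j).+1`!%:R)^-1 *: x (2 * j).+1).

(* Expansion of Lambda_d / h about the midpoint in time. *)
Definition midpoint_series Lam (m : nat) (x : jet) : R :=
  series_comp Lam (midpoint_curve x) m.

Definition jet_lagrangian Lam (m : nat) (x : jet) : R :=
  \sum_(i < m.+1) (2 / 2 ^+ (2 * i) - 1) * (bernoulli (2 * i) / (2 * i)`!%:R) *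
    iter (2 * i) total_dt (midpoint_series Lam (m - i)) x.

(* [Lam_m] is the modified Lagrangian of [Lam] on [S]; the equation determines
   the coefficients of [Lam_m] recursively, since the m-th coefficient on the
   right only involves those of [Lam_m] of index < m: see
   [modified_lagrangian_exists] and [modified_lagrangian_unique]. *)
Definition modified_lagrangian (S : set phase) Lam Lam_m : Prop :=
  forall m x, S x -> Lam_m m x = reduce_EL_series Lam_m (jet_lagrangian Lam) m x.

Lemma jet_lagrangian0 Lam (x : jet) : jet_lagrangian Lam 0 x = on_jets (Lam 0%N) x.
Proof.
rewrite /jet_lagrangian big_ord1 /= muln0 expr0 divr1 fact0 divr1 subn0.
rewrite /midpoint_series /series_comp big_ord1 /= /taylor_coef /= big_ord1.
rewrite expr0 scale1r fact0 divr1 /midpoint_curve muln0 expr0 mul1r fact0.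
have -> : bernoulli 0 = 1 :> R.
  by have := bernoulli_sum R 0; rewrite big_ord1 /= bin0 mul1r.
by rewrite mulr1 -[2]/(1 + 1) addrK mul1r invr1 !scale1r.
Qed.

Lemma jet_lagrangian0_local Lam (c d : nat -> jet) (s : R) (m : nat) :
  (forall l, c l 0%N = d l 0%N) -> (forall l, c l 1%N = d l 1%N) ->
  jet_lagrangian Lam 0 (\sum_(l < m.+1) s ^+ l *: c l) =
  jet_lagrangian Lam 0 (\sum_(l < m.+1) s ^+ l *: d l).
Proof.
move=> cd0 cd1; rewrite 2!jet_lagrangian0 /on_jets.
have E k : (forall l, c l k = d l k) ->
    (\sum_(l < m.+1) s ^+ l *: c l) k = (\sum_(l < m.+1) s ^+ l *: d l) k.
  move=> cd; rewrite (fct_sumE _ _ (fun l : 'I_m.+1 => s ^+ l *: c l)).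
  rewrite (fct_sumE _ _ (fun l : 'I_m.+1 => s ^+ l *: d l)).
  by apply: eq_bigr => l _; rewrite /GRing.scale /= cd.
by rewrite (E 0%N cd0) (E 1%N cd1).
Qed.

Section locality.
Context (S : set phase) (A B : nat -> phase -> R) (m : nat) (S_open : open S)
  (AB : forall i x, (i < m)%N -> S x -> A i x = B i x).

Let derive_local (V : normedModType R) (f g : phase -> V) (v x : phase) :
  S x -> (forall y, S y -> f y = g y) -> 'D_v f x = 'D_v g x.
Proof.
move=> Sx fg; apply: near_eq_derive.
have : nbhs x S by exact: open_nbhs_nbhs.
by apply: filterS => y /fg.
Qed.

Let EL_series_local i x : (i < m)%N -> S x -> EL_series A i x = EL_series B i x.
Proof.
move=> im Sx.
have AB' j : (j < m)%N -> forall y, S y -> A j y = B j y.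
  by move=> jm y Sy; exact: AB.
have pq j : (j < m)%N -> forall a y, S y ->
    partial_q a (A j) y = partial_q a (B j) y.
  by move=> jm a y Sy; apply: derive_local => //; exact: AB'.
have pv j : (j < m)%N -> forall a y, S y ->
    partial_v a (A j) y = partial_v a (B j) y.
  by move=> jm a y Sy; apply: derive_local => //; exact: AB'.
have hvv j : (j < m)%N -> hess_vv (A j) x = hess_vv (B j) x.
  move=> jm; apply: eq_mx => a b.
  by apply: (derive_local _ Sx) => y Sy; exact (pv _ jm b y Sy).
have hqv j : (j < m)%N -> hess_qv (A j) x = hess_qv (B j) x.
  move=> jm; apply: eq_mx => a b.
  by apply: (derive_local _ Sx) => y Sy; exact (pq _ jm b y Sy).
have gq j : (j < m)%N -> grad_q (A j) x = grad_q (B j) x.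
  by move=> jm; apply/colP => a; rewrite !mxE; exact: pq.
have inv j : (j < m)%N -> series_invmx (fun j => hess_vv (A j) x) j =
    series_invmx (fun j => hess_vv (B j) x) j.
  by move=> jm; apply: eq_series_invmx => k kj; apply: hvv; exact: leq_ltn_trans jm.
apply: eq_bigr => j _; have jm : (j < m)%N := leq_ltn_trans (leq_ord j) im.
have ijm : (i - j < m)%N by exact: leq_ltn_trans (leq_subr _ _) im.
apply: f_equal2; first exact (inv j jm).
apply: f_equal2; first exact (gq _ ijm).
exact (f_equal (fun M => - (M *m x.2)) (hqv _ ijm)).
Qed.

Let jet_along_series_local (f g : nat -> phase -> 'cV[R]_n) k :
  (forall i x, (i < m)%N -> S x -> f i x = g i x) ->
  forall i x, (i < m)%N -> S x ->
  jet_along_series f k i x = jet_along_series g k i x.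
Proof.
move=> fg; case: k => [|[|k]] /=; [by [] | by [] |].
elim: k => [|k IH] i x im Sx /=; first exact: fg.
rewrite /dt_along_series; apply: (@f_equal2 _ _ _ (@GRing.add _)).
  by apply: (derive_local _ Sx) => y Sy; exact: IH.
apply: eq_bigr => j _; rewrite (fg _ _ (leq_ltn_trans (leq_ord j) im) Sx).
apply: (derive_local _ Sx) => y Sy; apply: IH Sy.
exact: leq_ltn_trans (leq_subr _ _) im.
Qed.

Lemma reduce_EL_series_local Lam x : S x ->
  reduce_EL_series A (jet_lagrangian Lam) m x =
  reduce_EL_series B (jet_lagrangian Lam) m x.
Proof.
move=> Sx; apply: eq_bigr => -[[|i] im] _; apply: eq_taylor_coef => s.
  pose c Lam' l k := jet_along_series (EL_series Lam') k l x.
  have c0 l : c A l 0%N = c B l 0%N by rewrite /c /jet_along_series.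
  have c1 l : c A l 1%N = c B l 1%N by rewrite /c /jet_along_series.
  exact (@jet_lagrangian0_local Lam (c A) (c B) s (m - 0) c0 c1).
apply: (f_equal (jet_lagrangian _ _)).
apply: eq_bigr => -[l lm] _; apply: (f_equal ( *:%R _)); apply/funext => k.
apply: (jet_along_series_local _ EL_series_local _ Sx); apply: leq_trans lm _.
by rewrite subnSK// leq_subr.
Qed.

End locality.

Lemma modified_lagrangian_exists Lam :
  exists Lam_m, modified_lagrangian setT Lam Lam_m.
Proof.
pose step m f : phase -> R := reduce_EL_series f (jet_lagrangian Lam) m.
have ext k f g : (forall i, (i < k)%N -> f i = g i) -> step k f = step k g.
  move=> fg; apply/funext => x.
  apply: (@reduce_EL_series_local setT f g k openT _ Lam x I) => i y ik _.
  by rewrite (fg i ik).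
exists (srec (fun=> 0) step) => m x _.
by have -> : srec (fun=> 0) step m = step m (srec (fun=> 0) step) by exact: srecE.
Qed.

Lemma modified_lagrangian_unique (S : set phase) Lam (A B : nat -> phase -> R) :
  open S -> modified_lagrangian S Lam A -> modified_lagrangian S Lam B ->
  forall m x, S x -> A m x = B m x.
Proof.
move=> So HA HB; elim/ltn_ind => m IH x Sx.
rewrite (HA m x Sx) (HB m x Sx).
by apply: (@reduce_EL_series_local S A B m So _ Lam x Sx) => i y im; exact: IH.
Qed.

Definition theta2 K (x : jet) : R :=
  8^-1 * dotp (grad_q K (x 0%N, x 1%N)) (x 2%N)
  + 24^-1 * dotp (grad_v K (x 0%N, x 1%N)) (x 3%N).

Definition theta4 K (x : jet) : R :=
  384^-1 * dotp (grad_q K (x 0%N, x 1%N)) (x 4%N)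
  + 1920^-1 * dotp (grad_v K (x 0%N, x 1%N)) (x 5%N)
  + 128^-1 * bilin (x 2%N) (hess_qq K (x 0%N, x 1%N)) (x 2%N)
  + 1152^-1 * bilin (x 3%N) (hess_vv K (x 0%N, x 1%N)) (x 3%N)
  + 192^-1 * bilin (x 3%N) (hess_qv K (x 0%N, x 1%N)) (x 2%N).

Definition Phi2 L K : phase -> R :=
  reduce_EL L (fun x => theta2 K x - 24^-1 * iter 2 total_dt (on_jets K) x).

Definition Phi4 L K : phase -> R :=
  reduce_EL L
    (fun x => theta4 K x + 7 / 5760 * iter 4 total_dt (on_jets K) x).

(* The fourth order surrogate Lagrangian. *)
Definition surrogate4 L (i : nat) (x : phase) : R :=
  match i with
  | 0 => L x
  | 1 => - Phi2 L L x
  | 2 => - Phi4 L L x + Phi2 L (Phi2 L L) x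
         + 24^-1 * reduce_EL L (iter 2 total_dt (theta2 L)) x
  | _ => 0
  end.

End Lagrangians.
Arguments phase R n : clear implicits.
Arguments jet R n : clear implicits.

(* Main.v *)
(* On series that do not depend on h (up to the order considered), eliminating
   q'', q^(3), ... with the Euler-Lagrange series amounts to the substitution
   [reduce_EL L].  By induction on m < 3 the coefficients of the modified
   Lagrangian below m are those of L, so the m-th one is the m-th coefficient of
   the jet Lagrangian of the surrogate, reduced by L.  With K = Phi2(L),
     jet_1 = theta2(L) - K - (1/24) L'',
     jet_2 = theta4(L) - theta2(K) + Lhat_2
             - (1/24) (theta2(L) - K)'' + (7/5760) L''''
   and both reduce to 0 by the choice of the surrogate.  The analytic content is
   that all functions involved are smooth, so that total derivatives are linear,
   and the symmetry of second derivatives, used in the Taylor coefficient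
   theta4. *)
From HB Require Import structures.
Require Import Defs.
From mathcomp Require Import all_boot all_order all_algebra.
From mathcomp Require Import all_classical all_reals.
From mathcomp Require Import topology normedtype landau derive.
From mathcomp Require Import ring lra.
Import Order.TTheory GRing.Theory Num.Theory.
Import numFieldNormedType.Exports.
Local Open Scope classical_set_scope.
Local Open Scope ring_scope.

Set Implicit Arguments.
Unset Strict Implicit.
Unset Printing Implicit Defensive.

(** * Smooth functions on an open set *)

(** Differentiability is a property of the germ: the first order expansion of [f] at [x] is also one
    of [g], and uniqueness of the differential gives ['d g x = 'd f x]. *)
Lemma near_eq_differentiable (R : numFieldType) (V W : normedModType R)
    (f g : V -> W) (x : V) :
  (\near x, f x = g x) -> differentiable f x -> differentiable g x.
Proof.
move=> fg df; have fgx := nbhs_singleton fg.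
have Dg : g \o shift x = cst (g x) + 'd f x +o_ 0 id.
  apply/eqaddoP => e e0; have := diff_locally df; move/eqaddoP => /(_ e e0).
  have fg0 : \forall y \near (0 : V), f (y + x) = g (y + x).
    rewrite (near_shift x 0) /=; apply: filterS fg => y /=.
    by rewrite sub0r subrK.
  by apply: filterS2 fg0 => y /= fgy; rewrite !fctE /= fgx fgy.
have dE : 'd g x = 'd f x :> (V -> W) by apply: diff_unique Dg; exact: diff_continuous.
by apply/diff_locallyP; rewrite dE; split => //; exact: diff_continuous.
Qed.

Section smooth.
Context {R : realType} {V : normedModType R} (S : set V) (S_open : open S).
Implicit Types (f g K : V -> R) (x v : V).

Let nearS x : S x -> \forall y \near x, S y.
Proof. by move=> Sx; exact: open_nbhs_nbhs. Qed.

Lemma derive_eq_on (W : normedModType R) (f g : V -> W) v x :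
  S x -> {in S, f =1 g} -> 'D_v f x = 'D_v g x.
Proof.
move=> Sx fg; apply: near_eq_derive.
by apply: filterS (nearS Sx) => y Sy; apply: fg; rewrite inE.
Qed.

Lemma differentiable_eq_on (W : normedModType R) (f g : V -> W) x :
  S x -> {in S, f =1 g} -> differentiable f x -> differentiable g x.
Proof.
move=> Sx fg; apply: near_eq_differentiable.
by apply: filterS (nearS Sx) => y Sy; apply: fg; rewrite inE.
Qed.

(** Coinduction principle for [smooth_on]: [P] plays the role of an invariant preserved by
    differentiation, up to equality on [S]. The list [vs] is peeled from its right end because
    [foldr] takes the derivative along the last vector first. *)
Lemma smooth_on_coind (P : (V -> R) -> Prop) :
  (forall f x, P f -> S x -> differentiable f x) ->
  (forall f v, P f -> exists2 g, P g & {in S, 'D_v f =1 g}) ->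
  forall f, P f -> smooth_on S f.
Proof.
move=> Pdiff Pder f Pf vs x Sx.
have : exists2 g, P g & {in S, f =1 g} by exists f.
elim/last_ind: vs f {Pf} => [|vs v IH] f [g Pg fg] /=.
  by apply: (differentiable_eq_on Sx _ (Pdiff _ _ Pg Sx)) => y /fg.
rewrite foldr_rcons; apply: IH; have [g' Pg' gg'] := Pder _ v Pg.
exists g' => // y yS; rewrite -gg'//; apply: derive_eq_on => //.
by rewrite -inE.
Qed.

Lemma smooth_on_diff f x : smooth_on S f -> S x -> differentiable f x.
Proof. by move=> sf; exact: (sf [::]). Qed.

Lemma smooth_on_derive f v : smooth_on S f -> smooth_on S ('D_v f).
Proof. by move=> sf vs x Sx; have := sf (rcons vs v) x Sx; rewrite foldr_rcons. Qed.

(** The derivative of a product or of an inverse mixes sums, products and inverses, so the invariant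
    fed to [smooth_on_coind] has to be closed under all these operations at once. *)
Inductive smooth_alg : (V -> R) -> Prop :=
| Alg_smooth f : smooth_on S f -> smooth_alg f
| Alg_add f g : smooth_alg f -> smooth_alg g -> smooth_alg (f \+ g)
| Alg_mul f g : smooth_alg f -> smooth_alg g -> smooth_alg (f \* g)
| Alg_inv f : smooth_alg f -> (forall x, S x -> f x != 0) ->
    smooth_alg (fun x => (f x)^-1)
| Alg_cst c : smooth_alg (cst c).

Lemma smooth_algW f : smooth_alg f -> smooth_on S f.
Proof.
have Adiff g x : smooth_alg g -> S x -> differentiable g x.
  move=> + Sx; elim=> {g} [g sg|f1 g _ df _ dg|f1 g _ df _ dg|g _ dg g0|c].
  - exact: smooth_on_diff.
  - exact: differentiableD.
  - exact: differentiableM.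
  - exact: differentiableV (g0 _ Sx).
  - exact: differentiable_cst.
have Ader g x v : smooth_alg g -> S x -> derivable g x v.
  by move=> Ag Sx; apply: diff_derivable; exact: Adiff.
apply: smooth_on_coind => // {}f v; elim=> {f}
  [g sg|f1 g Af [f' Af' ff'] Ag [g' Ag' gg']|f1 g Af [f' Af' ff'] Ag [g' Ag' gg']
  |g Ag [g' Ag' gg'] g0|c].
- by exists ('D_v g) => //; apply: Alg_smooth; exact: smooth_on_derive.
- exists (f' \+ g'); first exact: Alg_add.
  move=> x xS; have /set_mem Sx := xS.
  by rewrite deriveD /= ?ff' ?gg'//; exact: Ader.
- exists ((f1 \* g') \+ (g \* f')).
    by apply: Alg_add; exact: Alg_mul.
  move=> x xS; have /set_mem Sx := xS.
  by rewrite deriveM /= ?ff' ?gg'//; exact: Ader.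
(* This is [- g' / g^2], written with the constructors of [smooth_alg]. *)
- exists ((cst (-1) \* ((fun x => (g x)^-1) \* (fun x => (g x)^-1))) \* g').
    by do 3?[apply: Alg_mul => //]; [exact: Alg_cst| |]; exact: Alg_inv.
  move=> x xS; have /set_mem Sx := xS.
  rewrite deriveV ?g0//=; last exact: Ader.
  by rewrite gg'// [LHS]/GRing.scale /= mulN1r expr2 invfM.
- exists (cst 0); first exact: Alg_cst.
  by move=> x _; rewrite derive_cst.
Qed.

Lemma smooth_onD f g : smooth_on S f -> smooth_on S g ->
  smooth_on S (fun x => f x + g x).
Proof.
by move=> sf sg; apply: smooth_algW; apply: Alg_add; exact: Alg_smooth.
Qed.

Lemma smooth_onM f g : smooth_on S f -> smooth_on S g ->
  smooth_on S (fun x => f x * g x).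
Proof.
by move=> sf sg; apply: smooth_algW; apply: Alg_mul; exact: Alg_smooth.
Qed.

Lemma smooth_onV f : smooth_on S f -> (forall x, S x -> f x != 0) ->
  smooth_on S (fun x => (f x)^-1).
Proof.
by move=> sf f0; apply: smooth_algW; apply: Alg_inv => //; exact: Alg_smooth.
Qed.

Lemma smooth_on_cst c : smooth_on S (cst c).
Proof. by apply: smooth_algW; exact: Alg_cst. Qed.

(** Since [S] is open, equality on [S] passes to directional derivatives, hence to all iterated
    ones. *)
Lemma smooth_on_eq f g : {in S, f =1 g} -> smooth_on S g -> smooth_on S f.
Proof.
move=> fg sg; apply: (@smooth_on_coind (fun f => exists2 g, smooth_on S g &
    {in S, f =1 g})); last by exists g.
- move=> {sg fg}f' x [h sh fh] Sx.
  by apply: (differentiable_eq_on Sx _ (smooth_on_diff sh Sx)) => y /fh.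
- move=> {sg fg}f' v [h sh fh]; exists ('D_v h).
    by exists ('D_v h) => //; exact: smooth_on_derive.
  by move=> x /set_mem Sx; exact: derive_eq_on.
Qed.

Lemma smooth_onZ c f : smooth_on S f -> smooth_on S (fun x => c * f x).
Proof. by move=> sf; apply: (smooth_onM (smooth_on_cst c)). Qed.

Lemma smooth_onN f : smooth_on S f -> smooth_on S (fun x => - f x).
Proof.
move=> /(smooth_onZ (-1)); apply: smooth_on_eq => x _.
by rewrite mulN1r.
Qed.

Lemma smooth_onB f g : smooth_on S f -> smooth_on S g ->
  smooth_on S (fun x => f x - g x).
Proof. by move=> sf sg; apply: smooth_onD => //; exact: smooth_onN. Qed.

Lemma smooth_on_sum (I : Type) (r : seq I) (P : pred I) (F : I -> V -> R) :
  (forall i, smooth_on S (F i)) -> smooth_on S (fun x => \sum_(i <- r | P i) F i x).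
Proof.
move=> sF; elim: r => [|i r IH].
  by apply: smooth_on_eq (smooth_on_cst 0) => x _; rewrite big_nil.
case: (boolP (P i)) => Pi.
  by apply: smooth_on_eq (smooth_onD (sF i) IH) => x _; rewrite big_cons Pi.
by apply: smooth_on_eq IH => x _; rewrite big_cons (negbTE Pi).
Qed.

Lemma smooth_on_prod (I : Type) (r : seq I) (P : pred I) (F : I -> V -> R) :
  (forall i, smooth_on S (F i)) -> smooth_on S (fun x => \prod_(i <- r | P i) F i x).
Proof.
move=> sF; elim: r => [|i r IH].
  by apply: smooth_on_eq (smooth_on_cst 1) => x _; rewrite big_nil.
case: (boolP (P i)) => Pi.
  by apply: smooth_on_eq (smooth_onM (sF i) IH) => x _; rewrite big_cons Pi.
by apply: smooth_on_eq IH => x _; rewrite big_cons (negbTE Pi).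
Qed.

Lemma smooth_on_det (m : nat) (A : V -> 'M[R]_m) :
  (forall i j, smooth_on S (fun x => A x i j)) -> smooth_on S (fun x => \det (A x)).
Proof.
move=> sA; apply: smooth_on_sum => s; apply: smooth_onZ.
by apply: smooth_on_prod => i.
Qed.

(** Cramer's rule: each entry of the inverse is a cofactor, with transposed indices, divided by the
    determinant. *)
Lemma smooth_on_invmx (m : nat) (A : V -> 'M[R]_m) :
  (forall i j, smooth_on S (fun x => A x i j)) ->
  (forall x, S x -> A x \in unitmx) ->
  forall i j, smooth_on S (fun x => invmx (A x) i j).
Proof.
move=> sA uA i j.
have sC : smooth_on S (fun x => (-1) ^+ (j + i) *
    \det (row' j (col' i (A x)))).
  apply: smooth_onZ; apply: smooth_on_det => k l.
  by apply: smooth_on_eq (sA (lift j k) (lift i l)) => x _; rewrite !mxE.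
have dA0 x : S x -> \det (A x) != 0 by move=> /uA; rewrite unitmxE unitfE.
apply: smooth_on_eq (smooth_onM (smooth_onV (smooth_on_det sA) dA0) sC) => x.
by move=> /set_mem Sx; rewrite /invmx uA// !mxE.
Qed.

Lemma smooth_on_mulmx (m n p : nat) (A : V -> 'M[R]_(m, n)) (B : V -> 'M[R]_(n, p)) :
  (forall i j, smooth_on S (fun x => A x i j)) ->
  (forall i j, smooth_on S (fun x => B x i j)) ->
  forall i j, smooth_on S (fun x => (A x *m B x) i j).
Proof.
move=> sA sB i j.
apply: smooth_on_eq (smooth_on_sum _ _ (fun k => smooth_onM (sA i k) (sB k j))).
by move=> x _; rewrite mxE.
Qed.

End smooth.

(** * Chain rule and Schwarz's theorem *)

Section chain.
Context {R : realType} {V : normedModType R}.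

Lemma is_derive_curve (W : normedModType R) (K : V -> W) (c : R -> V)
    (s : R) (dc : V) :
  is_derive s 1 c dc -> differentiable K (c s) ->
  is_derive s 1 (K \o c) ('D_dc K (c s)).
Proof.
move=> [dcs <-] dK.
have dfc : differentiable c s by apply/derivable1_diffP.
apply: DeriveDef; first by apply: diff_derivable; exact: differentiable_comp.
rewrite deriveE; last exact: differentiable_comp.
by rewrite diff_comp//= (@deriveE _ _ _ _ _ _ dK) (@deriveE _ _ _ _ _ _ dfc).
Qed.

Lemma is_derive_scalel (k : R -> R) (s dk : R) (c : V) :
  is_derive s 1 k dk -> is_derive s 1 (fun s => k s *: c) (dk *: c).
Proof.
move=> [dks <-]; have dfk : differentiable k s by apply/derivable1_diffP.
apply: DeriveDef; first by apply: diff_derivable; exact: differentiableZl.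
by rewrite deriveE; [rewrite diffZl//= -deriveE|exact: differentiableZl].
Qed.

Lemma is_derive_line (u w : V) (s : R) : is_derive s 1 (fun s => s *: u + w) u.
Proof.
have Hl := is_derive_scalel u (is_derive_id s 1).
have := is_deriveD Hl (is_derive_cst w s 1).
by rewrite scale1r addr0.
Qed.

End chain.

Section Schwarz.
Context {R : realType} {V : normedModType R} (S : set V) (S_open : open S).

(* The mean value theorem, once along [u] and once along [v]. *)
Let second_difference (K : V -> R) (u v x : V) (h : R) :
  smooth_on S K -> 0 < h ->
  (forall s t : R, 0 <= s <= h -> 0 <= t <= h -> S (s *: u + (t *: v + x))) ->
  exists s t : R, [/\ 0 <= s <= h, 0 <= t <= h &
    K (h *: u + (h *: v + x)) - K (h *: u + x) - (K (h *: v + x) - K x) =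
    'D_v ('D_u K) (s *: u + (t *: v + x)) * h * h].
Proof.
move=> sK h0 Sst.
have h00 : (0 : R) <= 0 <= h by rewrite lexx ltW.
have hh : 0 <= h <= h by rewrite lexx ltW.
have S0 s : 0 <= s <= h -> S (s *: u + x).
  by move=> sh; have := Sst s 0 sh h00; rewrite scale0r add0r.
pose phi s := K (s *: u + (h *: v + x)) - K (s *: u + x).
have dphi s : 0 <= s <= h -> is_derive s 1 phi
    ('D_u K (s *: u + (h *: v + x)) - 'D_u K (s *: u + x)).
  move=> sh.
  have dK1 := smooth_on_diff sK (Sst s h sh hh).
  have dK2 := smooth_on_diff sK (S0 s sh).
  exact: is_deriveB (is_derive_curve (is_derive_line u (h *: v + x) s) dK1)
                    (is_derive_curve (is_derive_line u x s) dK2).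
have oc s : s \in `]0, h[%R -> 0 <= s <= h.
  by rewrite in_itv /= => /andP[/ltW -> /ltW ->].
have cc s : s \in `[0, h]%R -> 0 <= s <= h by rewrite in_itv.
have der_cont (f df : R -> R) : (forall s, 0 <= s <= h -> is_derive s 1 f (df s)) ->
    {within `[0, h], continuous f}.
  move=> fdf; apply: derivable_within_continuous => s /cc sh.
  by have [] := fdf s sh.
have [s /oc sh] := MVT h0 (fun s sh => dphi s (oc s sh)) (der_cont _ _ dphi).
rewrite /phi scale0r !add0r subr0 => E1.
(* The intermediate point [s] is now fixed: the second difference has become [h] times an increment
   of ['D_u K] in the direction [v]. *)
pose psi t := 'D_u K (t *: v + (s *: u + x)).
have Sts t : 0 <= t <= h -> S (t *: v + (s *: u + x)).
  by move=> th; rewrite addrCA; exact: Sst.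
have dpsi t : 0 <= t <= h ->
    is_derive t 1 psi ('D_v ('D_u K) (t *: v + (s *: u + x))).
  move=> th; have dK := smooth_on_diff (smooth_on_derive u sK) (Sts t th).
  exact: is_derive_curve (is_derive_line v (s *: u + x) t) dK.
have [t /oc th] := MVT h0 (fun t th => dpsi t (oc t th)) (der_cont _ _ dpsi).
rewrite /psi scale0r add0r subr0 => E2.
exists s, t; split => //; rewrite [s *: u + (t *: _ + _)]addrCA -E2.
rewrite -[h *: v + (s *: u + x)]addrCA -E1.
by rewrite opprB addrACA [- K _ + _]addrC.
Qed.

(** The second difference is symmetric in [u] and [v]. Divided by [h * h], it is a value of [A] and
    also a value of [B], both taken in a small parallelogram at [x]; continuity at [x] concludes.
    [A] and [B] stand for the two mixed derivatives. *)
Let second_difference_lim (K A B : V -> R) (u v x : V) : S x ->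
  {for x, continuous A} -> {for x, continuous B} ->
  (forall h : R, 0 < h ->
    (forall s t : R, 0 <= s <= h -> 0 <= t <= h -> S (s *: u + (t *: v + x))) ->
    exists s t : R, [/\ 0 <= s <= h, 0 <= t <= h &
      K (h *: u + (h *: v + x)) - K (h *: u + x) - (K (h *: v + x) - K x) =
      B (s *: u + (t *: v + x)) * h * h]) ->
  (forall h : R, 0 < h ->
    (forall s t : R, 0 <= s <= h -> 0 <= t <= h -> S (s *: v + (t *: u + x))) ->
    exists s t : R, [/\ 0 <= s <= h, 0 <= t <= h &
      K (h *: v + (h *: u + x)) - K (h *: v + x) - (K (h *: u + x) - K x) =
      A (s *: v + (t *: u + x)) * h * h]) ->
  A x = B x.
Proof.
move=> Sx contA contB dif_uv dif_vu.
apply/eqP; rewrite -subr_eq0 -normr_le0; apply/ler_addgt0Pl => e e0.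
rewrite addr0.
have e20 : 0 < e / 2 by rewrite divr_gt0.
have [r /= r0 xr] : exists2 r, 0 < r & forall p, ball x r p ->
    [/\ S p, `|A x - A p| < e / 2 & `|B x - B p| < e / 2].
  have nS : nbhs x S by exact: open_nbhs_nbhs.
  have cA : nbhs x [set p | `|A x - A p| < e / 2].
    by move/cvgrPdist_lt : contA; exact.
  have cB : nbhs x [set p | `|B x - B p| < e / 2].
    by move/cvgrPdist_lt : contB; exact.
  have /nbhs_ballP[r r0 xr] : nbhs x (S `&` ([set p | `|A x - A p| < e / 2] `&`
      [set p | `|B x - B p| < e / 2])).
    by apply: filterI => //; exact: filterI.
  by exists r => // p /xr[Sp [Ap Bp]]; split.
(* The parallelogram of side [h = r / M] stays within [h * (|u| + |v|) < r] of [x]. The added 1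
   makes this strict, and keeps [M] positive when [u] and [v] vanish. *)
pose M := `|u| + `|v| + 1.
have M0 : 0 < M by rewrite ltr_wpDl// addr_ge0.
have [h h0 hM] : exists2 h : R, 0 < h & h * M = r.
  by exists (r / M); [rewrite divr_gt0|rewrite divfK// gt_eqF].
have ball_st s t : 0 <= s <= h -> 0 <= t <= h ->
    ball x r (s *: u + (t *: v + x)).
  move=> /andP[s0 sh] /andP[t0 th]; rewrite -ball_normE /= addrA opprD addrCA.
  rewrite subrr addr0 normrN (le_lt_trans (ler_normD _ _))// !normrZ !ger0_norm//.
  apply: (@le_lt_trans _ _ (h * (`|u| + `|v|))).
    by rewrite mulrDr lerD// ler_wpM2r.
  by rewrite -hM ltr_pM2l// /M ltrDl.
have S_uv s t : 0 <= s <= h -> 0 <= t <= h -> S (s *: u + (t *: v + x)).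
  by move=> sh th; have [] := xr _ (ball_st s t sh th).
have S_vu s t : 0 <= s <= h -> 0 <= t <= h -> S (s *: v + (t *: u + x)).
  by move=> sh th; rewrite addrCA; exact: S_uv.
have [s [t [sh th Est]]] := dif_uv h h0 S_uv.
have [s' [t' [sh' th' Est']]] := dif_vu h h0 S_vu.
have AB : A (s' *: v + (t' *: u + x)) = B (s *: u + (t *: v + x)).
  have hh : h * h != 0 by rewrite mulf_neq0// gt_eqF.
  have : A (s' *: v + (t' *: u + x)) * h * h = B (s *: u + (t *: v + x)) * h * h.
    by rewrite -Est -Est' [h *: v + (h *: u + x)]addrCA; ring.
  by rewrite -!mulrA => E; exact: (mulIf hh E).
have [_ Ax _] := xr _ (ball_st t' s' th' sh').
have [_ _ Bx] := xr _ (ball_st s t sh th).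
rewrite addrCA AB in Ax.
rewrite -(subrKA (B (s *: u + (t *: v + x)))) (splitr e).
rewrite (le_trans (ler_normD _ _))// lerD// ltW//.
by rewrite distrC.
Qed.

Lemma derive_comm (K : V -> R) (u v x : V) : smooth_on S K -> S x ->
  'D_u ('D_v K) x = 'D_v ('D_u K) x.
Proof.
move=> sK Sx.
have cont w w' : {for x, continuous ('D_w ('D_w' K))}.
  apply: differentiable_continuous.
  by apply: smooth_on_diff Sx; do 2!apply: smooth_on_derive.
apply: (second_difference_lim Sx (cont u v) (cont v u)) => h.
  exact: second_difference.
exact: second_difference.
Qed.

End Schwarz.

(** * Functions on phase space *)

(** The first derivative of a continuous linear form is constant, so the higher ones reduce to
    [smooth_on_cst]. *)
Lemma smooth_on_linear (R : realType) (V : normedModType R) (S : set V)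
    (S_open : open S) (f : {linear V -> R}) : continuous f -> smooth_on S f.
Proof.
move=> cf; elim/last_ind => [|vs v _] x Sx; first exact: linear_differentiable.
rewrite foldr_rcons.
have -> : 'D_v f = cst (f v).
  apply/funext => y; rewrite deriveE; last exact: linear_differentiable.
  by rewrite diff_lin.
exact: (smooth_on_cst S_open (f v) vs Sx).
Qed.

Section phase_functions.
Context {R : realType} {n : nat} (S : set (phase R n)) (S_open : open S).
Implicit Types (K L : phase R n -> R) (f g : phase R n -> 'cV[R]_n) (x : phase R n).

(** Coordinatewise, because [smooth_on] concerns scalar functions. *)
Definition smooth_vec g := forall i, smooth_on S (fun x => g x i 0).

Lemma smooth_vec_fst : smooth_vec fst.
Proof.
move=> i.
have lin : linear (fun x : phase R n => x.1 i 0 : R^o) by move=> a x y; rewrite !mxE.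
pose linM := GRing.isLinear.Build _ _ _ _ _ lin.
pose linL : {linear phase R n -> R} := HB.pack (fun x : phase R n => x.1 i 0) linM.
apply: (@smooth_on_linear _ _ S S_open linL) => x.
apply: (@continuous_comp _ _ _ fst (fun u : 'cV[R]_n => u i 0) x).
  exact: cvg_fst.
exact: coord_continuous.
Qed.

Lemma smooth_vec_snd : smooth_vec snd.
Proof.
move=> i.
have lin : linear (fun x : phase R n => x.2 i 0 : R^o) by move=> a x y; rewrite !mxE.
pose linM := GRing.isLinear.Build _ _ _ _ _ lin.
pose linL : {linear phase R n -> R} := HB.pack (fun x : phase R n => x.2 i 0) linM.
apply: (@smooth_on_linear _ _ S S_open linL) => x.
apply: (@continuous_comp _ _ _ snd (fun u : 'cV[R]_n => u i 0) x).
  exact: cvg_snd.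
exact: coord_continuous.
Qed.

Lemma derive_grad K x (a b : 'cV[R]_n) : differentiable K x ->
  'D_(a, b) K x = dotp (grad_q K x) a + dotp (grad_v K x) b.
Proof.
move=> dK.
have -> : (a, b) = \sum_i a i 0 *: (delta_mx i 0, 0) +
    \sum_i b i 0 *: (0, delta_mx i 0) :> phase R n.
  have E (c : 'cV[R]_n) : c = \sum_i c i 0 *: delta_mx i 0.
    rewrite [LHS]matrix_sum_delta; apply: eq_bigr => i _.
    by rewrite big_ord1.
  have El (c : 'cV[R]_n) :
      (c, 0) = \sum_i c i 0 *: (delta_mx i 0, 0) :> phase R n.
    rewrite {1}(E c) (big_morph (fun u : 'cV[R]_n => (u, 0) : phase R n)
      (id1 := 0) (op1 := +%R)) //.
      by apply: eq_bigr => i _; congr pair; rewrite scaler0.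
    by move=> u w; congr pair; rewrite addr0.
  have Er (c : 'cV[R]_n) :
      (0, c) = \sum_i c i 0 *: (0, delta_mx i 0) :> phase R n.
    rewrite {1}(E c) (big_morph (fun u : 'cV[R]_n => (0, u) : phase R n)
      (id1 := 0) (op1 := +%R)) //.
      by apply: eq_bigr => i _; congr pair; rewrite scaler0.
    by move=> u w; congr pair; rewrite addr0.
  by rewrite -El -Er; congr pair; rewrite ?addr0 ?add0r.
rewrite deriveE// linearD !linear_sum /dotp; congr (_ + _).
  by apply: eq_bigr => i _; rewrite linearZ /= -deriveE// mxE mulrC.
by apply: eq_bigr => i _; rewrite linearZ /= -deriveE// mxE mulrC.
Qed.

Lemma derive_coord (g : phase R n -> 'cV[R]_n) w x i :
  (forall i, differentiable (fun x => g x i 0) x) ->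
  'D_w g x i 0 = 'D_w (fun x => g x i 0) x.
Proof.
move=> dg; rewrite derive_mx ?mxE//; apply/derivable_mxP => k l.
by rewrite (ord1 l); exact: diff_derivable.
Qed.

Lemma smooth_on_dotp f g : smooth_vec f -> smooth_vec g ->
  smooth_on S (fun x => dotp (f x) (g x)).
Proof. by move=> sf sg; apply: smooth_on_sum => // i; exact: smooth_onM. Qed.

Lemma smooth_vec_grad_q K : smooth_on S K -> smooth_vec (grad_q K).
Proof.
move=> sK i; apply: (smooth_on_eq S_open _ (smooth_on_derive (delta_mx i 0, 0) sK)).
by move=> x _; rewrite mxE.
Qed.

Lemma smooth_vec_grad_v K : smooth_on S K -> smooth_vec (grad_v K).
Proof.
move=> sK i; apply: (smooth_on_eq S_open _ (smooth_on_derive (0, delta_mx i 0) sK)).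
by move=> x _; rewrite mxE.
Qed.

Lemma smooth_vec_dt_along f g :
  smooth_vec f -> smooth_vec g -> smooth_vec (dt_along f g).
Proof.
move=> sf sg i.
have gq := smooth_vec_grad_q (sg i); have gv := smooth_vec_grad_v (sg i).
(* The directions [(x.2, 0)] and [(0, f x)] vary with [x], so smoothness is read off the gradient
   formula [derive_grad]; the null field fills the missing component of each direction. *)
have z : smooth_vec (fun=> 0).
  move=> k; apply: (smooth_on_eq S_open _ (smooth_on_cst S_open 0)) => x _.
  by rewrite mxE.
have s1 := smooth_onD S_open (smooth_on_dotp gq smooth_vec_snd) (smooth_on_dotp gv z).
have s2 := smooth_onD S_open (smooth_on_dotp gq z) (smooth_on_dotp gv sf).
apply: (smooth_on_eq S_open _ (smooth_onD S_open s1 s2)) => x /set_mem Sx.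
have dg k : differentiable (fun x => g x k 0) x by exact: smooth_on_diff Sx.
by rewrite /dt_along mxE !derive_coord// !derive_grad.
Qed.

Section along.
Context (L : phase R n -> R) (sL : smooth_on S L)
  (L_regular : forall x, S x -> hess_vv L x \in unitmx).

Lemma smooth_vec_EL_field : smooth_vec (EL_field L).
Proof.
move=> i; apply: (smooth_on_mulmx S_open) => [k l|k l].
  apply: (smooth_on_invmx S_open) => // {}k {}l.
  apply: (smooth_on_eq S_open _ (smooth_on_derive (0, delta_mx k 0)
    (smooth_on_derive (0, delta_mx l 0) sL))) => x _.
  by rewrite mxE.
have sM : smooth_on S (fun x => (hess_qv L x *m x.2) k l).
  apply: (smooth_on_mulmx S_open) => k' l'.
    apply: (smooth_on_eq S_open _ (smooth_on_derive (0, delta_mx k' 0)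
      (smooth_on_derive (delta_mx l' 0, 0) sL))) => x _.
    by rewrite mxE.
  by rewrite (ord1 l'); exact: smooth_vec_snd.
rewrite (ord1 l) in sM *.
apply: (smooth_on_eq S_open _ (smooth_onB S_open (smooth_vec_grad_q sL k) sM)) => x _.
by rewrite mxE [X in _ + X]mxE.
Qed.

Lemma smooth_vec_jet_along k : smooth_vec (jet_along (EL_field L) k).
Proof.
case: k => [|[|k]]; [exact: smooth_vec_fst|exact: smooth_vec_snd|].
elim: k => [|k IH]; first exact: smooth_vec_EL_field.
exact: smooth_vec_dt_along smooth_vec_EL_field IH.
Qed.

End along.
End phase_functions.

(** * Taylor coefficients *)

Section taylor_lmod.
Context {R : realType} {V : lmodType R}.
Implicit Types (K : V -> R) (c : nat -> V).

Lemma taylor_coef0 K c : taylor_coef K c 0 = K (c 0%N).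
Proof. by rewrite /taylor_coef /= big_ord1 expr0 scale1r fact0 divr1. Qed.

(** The composite is constant in [s], whatever the regularity of [K]. A bare module suffices for
    [V], which lets the lemma be applied to [jet]. *)
Lemma taylor_coef_const K c m : (forall l, (0 < l)%N -> c l = 0) -> (0 < m)%N ->
  taylor_coef K c m = 0.
Proof.
move=> c0 m0; rewrite /taylor_coef.
have -> : (fun s : R => K (\sum_(l < m.+1) s ^+ l *: c l)) = cst (K (c 0%N)).
  apply/funext => s; rewrite big_ord_recl expr0 scale1r big1 ?addr0// => i _.
  by rewrite c0// scaler0.
case: m m0 => // m _; rewrite derive1Sn.
have -> : derive1 (cst (K (c 0%N)) : R -> R) = cst 0.
  by apply/funext => s; rewrite derive1_cst.
have -> : derive1n m (cst 0 : R -> R) = cst 0.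
  elim: m => // m IH; rewrite derive1nS IH.
  by apply/funext => s; rewrite derive1_cst.
by rewrite mul0r.
Qed.

End taylor_lmod.

Section taylor.
Context {R : realType} {V : normedModType R} (S : set V) (S_open : open S).
Implicit Types (K : V -> R) (c : nat -> V).

Lemma taylor_coef1 K c : smooth_on S K -> S (c 0%N) ->
  taylor_coef K c 1 = 'D_(c 1%N) K (c 0%N).
Proof.
move=> sK Sc; rewrite /taylor_coef (_ : 1`!%N = 1%N)// divr1 /derive1n /= derive1E.
have -> : (fun s : R => K (\sum_(l < 2) s ^+ l *: c l)) =
    K \o (fun s : R => s *: c 1%N + c 0%N).
  apply/funext => s; rewrite big_ord_recl big_ord1 /= expr0 expr1 scale1r.
  by rewrite addrC.
have dK : differentiable K (0 *: c 1%N + c 0%N).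
  by rewrite scale0r add0r; exact: smooth_on_diff Sc.
have [_ ->] := is_derive_curve (is_derive_line (c 1%N) (c 0%N) 0) dK.
by rewrite scale0r add0r.
Qed.

Lemma taylor_coef2 K c : smooth_on S K -> S (c 0%N) ->
  taylor_coef K c 2 = 'D_(c 2%N) K (c 0%N) +
    2^-1 * 'D_(c 1%N) ('D_(c 1%N) K) (c 0%N).
Proof.
move=> sK Sc; rewrite /taylor_coef.
pose C (s : R) : V := c 0%N + s *: c 1%N + (s * s) *: c 2%N.
have -> : (fun s : R => K (\sum_(l < 3) s ^+ l *: c l)) = K \o C.
  apply/funext => s; rewrite !big_ord_recl big_ord0 /= expr0 expr1 scale1r.
  by rewrite addr0 expr2 addrA.
have C0 : C 0 = c 0%N by rewrite /C mul0r !scale0r !addr0.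
have dC (s : R) : is_derive s 1 C (c 1%N + (s + s) *: c 2%N).
  have d1 := is_derive_scalel (c 1%N) (is_derive_id s 1).
  have d2 := is_derive_scalel (c 2%N)
    (is_deriveM (is_derive_id s 1) (is_derive_id s 1)).
  have d := is_deriveD (is_deriveD (is_derive_cst (c 0%N) s 1) d1) d2.
  apply: is_derive_eq d _; rewrite add0r scale1r.
  by rewrite /GRing.scale /= mulr1.
(* The formula [dK] for the first derivative holds only while the curve stays in [S]; holding near 0
   is enough to differentiate it once more at 0. *)
have near_S : \forall s \near (0 : R), S (C s).
  have cC : {for 0, continuous C}.
    by apply/differentiable_continuous/derivable1_diffP; case: (dC 0).
  apply: cC; rewrite C0; exact: open_nbhs_nbhs.
have dK (s : R) : S (C s) -> derive1 (K \o C) s =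
    'D_(c 1%N) K (C s) + (s + s) * 'D_(c 2%N) K (C s).
  move=> Ss; have dKs := smooth_on_diff sK Ss.
  rewrite derive1E; have [_ ->] := is_derive_curve (dC s) dKs.
  by rewrite deriveE// linearD linearZ /= -!deriveE.
(* In the derivative of [(s + s) * 'D_(c 2) K (C s)], the term where ['D_(c 2) K] is differentiated
   vanishes at 0. Division by [2!] then gives the stated coefficients. *)
have -> : derive1n 2 (K \o C) 0 =
    'D_(c 1%N) ('D_(c 1%N) K) (c 0%N) + 2 * 'D_(c 2%N) K (c 0%N).
  rewrite /derive1n /= derive1E.
  rewrite (@near_eq_derive _ _ _ _ (('D_(c 1%N) K \o C) +
    ((fun s => s + s) * ('D_(c 2%N) K \o C)))); last first.
    by apply: filterS near_S => s /dK.
  have dc := dC 0; have SC : S (C 0) by rewrite C0.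
  have dK1 := is_derive_curve dc (smooth_on_diff (smooth_on_derive (c 1%N) sK) SC).
  have dK2 := is_derive_curve dc (smooth_on_diff (smooth_on_derive (c 2%N) sK) SC).
  have dss := is_deriveD (is_derive_id (0 : R) 1) (is_derive_id (0 : R) 1).
  have [_ ->] := is_deriveD dK1 (is_deriveM dss dK2).
  rewrite /= C0 addr0 !scale0r addr0.
  have -> : (id + id : R -> R) 0 = 0 by rewrite fctE addr0.
  by rewrite scale0r add0r; congr (_ + _); exact: mulrC.
by rewrite (_ : 2`!%N = 2%N)//; field.
Qed.

End taylor.

(** * Second directional derivatives and Hessian blocks *)

Section quadratic.
Context {R : realType} {n : nat} (S : set (phase R n)) (S_open : open S).
Implicit Types (K : phase R n -> R) (x : phase R n) (a b : 'cV[R]_n).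

Lemma bilinE a (A : 'M[R]_n) b : bilin a A b = \sum_i \sum_j a i 0 * b j 0 * A i j.
Proof.
rewrite /bilin mxE exchange_big /=; apply: eq_bigr => j _.
rewrite mxE mulr_suml; apply: eq_bigr => i _; rewrite mxE; ring.
Qed.

Lemma bilinZ (k l : R) a (A : 'M[R]_n) b :
  bilin (k *: a) A (l *: b) = k * l * bilin a A b.
Proof.
rewrite !bilinE mulr_sumr; apply: eq_bigr => i _.
rewrite mulr_sumr; apply: eq_bigr => j _; rewrite !mxE; ring.
Qed.

Lemma dotpZr (k : R) a b : dotp a (k *: b) = k * dotp a b.
Proof. by rewrite /dotp mulr_sumr; apply: eq_bigr => i _; rewrite mxE mulrCA. Qed.

Lemma dotpNl a b : dotp (- a) b = - dotp a b.
Proof. by rewrite /dotp -sumrN; apply: eq_bigr => i _; rewrite mxE mulNr. Qed.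

Let dotp_sumE (g : phase R n -> 'cV[R]_n) a :
  (fun y => dotp (g y) a) = \sum_i (a i 0 \*: (fun y => g y i 0)).
Proof.
apply/funext => y; rewrite fct_sumE; apply: eq_bigr => i _.
exact: mulrC.
Qed.

Lemma derivable_dotpl (g : phase R n -> 'cV[R]_n) a w x :
  (forall i, differentiable (fun y => g y i 0) x) ->
  derivable (fun y => dotp (g y) a) x w.
Proof.
move=> dg; rewrite dotp_sumE.
by apply: derivable_sum => i; apply: derivableZ; exact: diff_derivable.
Qed.

Lemma derive_dotpl (g : phase R n -> 'cV[R]_n) a w x :
  (forall i, differentiable (fun y => g y i 0) x) ->
  'D_w (fun y => dotp (g y) a) x = \sum_i a i 0 * 'D_w (fun y => g y i 0) x.
Proof.
move=> dg; rewrite dotp_sumE derive_sum.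
  by apply: eq_bigr => i _; rewrite deriveZ//; exact: diff_derivable.
by move=> i; apply: derivableZ; exact: diff_derivable.
Qed.

(* Schwarz's theorem merges the two mixed terms into the single [hess_qv]. *)
Lemma derive2_hess K x a b : smooth_on S K -> S x ->
  'D_(a, b) ('D_(a, b) K) x =
    bilin a (hess_qq K x) a + bilin b (hess_vv K x) b + 2 * bilin b (hess_qv K x) a.
Proof.
move=> sK Sx.
have dq i : differentiable (partial_q i K) x.
  exact: smooth_on_diff (smooth_on_derive _ sK) Sx.
have dv i : differentiable (partial_v i K) x.
  exact: smooth_on_diff (smooth_on_derive _ sK) Sx.
have gqi i : (fun y => grad_q K y i 0) = partial_q i K.
  by apply/funext => y; rewrite mxE.
have gvi i : (fun y => grad_v K y i 0) = partial_v i K.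
  by apply/funext => y; rewrite mxE.
have dgq i : differentiable (fun y => grad_q K y i 0) x by rewrite gqi; exact: dq.
have dgv i : differentiable (fun y => grad_v K y i 0) x by rewrite gvi; exact: dv.
rewrite (@derive_eq_on _ _ S S_open _ _
  ((fun y => dotp (grad_q K y) a) + (fun y => dotp (grad_v K y) b))) //; last first.
  by move=> y /set_mem Sy; rewrite derive_grad//; exact: smooth_on_diff sK Sy.
rewrite deriveD; [|exact: derivable_dotpl|exact: derivable_dotpl].
rewrite !derive_dotpl//.
have Eq : \sum_i a i 0 * 'D_(a, b) (fun y => grad_q K y i 0) x =
    \sum_i a i 0 * dotp (grad_q (partial_q i K) x) a +
    \sum_i a i 0 * dotp (grad_v (partial_q i K) x) b.
  refine (eq_trans _ (big_split _ _ _ _ _)).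
  apply: eq_bigr => i _; refine (eq_trans _ (mulrDr _ _ _)).
  by rewrite -(derive_grad _ _ (dq i)) gqi.
have Ev : \sum_i b i 0 * 'D_(a, b) (fun y => grad_v K y i 0) x =
    \sum_i b i 0 * dotp (grad_q (partial_v i K) x) a +
    \sum_i b i 0 * dotp (grad_v (partial_v i K) x) b.
  refine (eq_trans _ (big_split _ _ _ _ _)).
  apply: eq_bigr => i _; refine (eq_trans _ (mulrDr _ _ _)).
  by rewrite -(derive_grad _ _ (dv i)) gvi.
(* With the index convention of the Hessians, three of the four blocks match after exchanging the
   two sums. Only in [Bvq] are the derivatives taken in the opposite order, which calls for
   [derive_comm]. *)
have Bqq : \sum_i a i 0 * dotp (grad_q (partial_q i K) x) a = bilin a (hess_qq K x) a.
  rewrite bilinE exchange_big; apply: eq_bigr => i _; rewrite mulr_sumr.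
  by apply: eq_bigr => j _; rewrite !mxE; ring.
have Bvv : \sum_i b i 0 * dotp (grad_v (partial_v i K) x) b = bilin b (hess_vv K x) b.
  rewrite bilinE exchange_big; apply: eq_bigr => i _; rewrite mulr_sumr.
  by apply: eq_bigr => j _; rewrite !mxE; ring.
have Bqv : \sum_i a i 0 * dotp (grad_v (partial_q i K) x) b = bilin b (hess_qv K x) a.
  rewrite bilinE exchange_big; apply: eq_bigr => i _; rewrite mulr_sumr.
  by apply: eq_bigr => j _; rewrite !mxE; ring.
have Bvq : \sum_i b i 0 * dotp (grad_q (partial_v i K) x) a = bilin b (hess_qv K x) a.
  rewrite bilinE; apply: eq_bigr => i _; rewrite mulr_sumr.
  apply: eq_bigr => j _; rewrite 2!mxE.
  have C (p q r s : R) : r = s -> p * (s * q) = p * q * r by move=> ->; ring.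
  exact/C/(derive_comm S_open (0, delta_mx i 0) (delta_mx j 0, 0) sK Sx).
refine (eq_trans (f_equal2 +%R (eq_trans Eq (f_equal2 +%R Bqq Bqv))
  (eq_trans Ev (f_equal2 +%R Bvq Bvv))) _).
have C (p q r : R) : p + r + (r + q) = p + q + 2 * r by ring.
exact: C.
Qed.

End quadratic.

(** * Functions on jets *)

Section jets.
Context {R : realType} {n : nat} (S : set (phase R n)) (S_open : open S).
Implicit Types (K L : phase R n -> R) (F G : jet R n -> R) (x : phase R n)
  (y : jet R n).

Definition jets_over : set (jet R n) := [set y | S (y 0%N, y 1%N)].

(* [total_dt] is linear only where the limits defining it exist (elsewhere a
   derivative is a junk value); this class contains every jet function that
   occurs, is stable under [total_dt], and is mapped to smooth functions by
   [reduce_EL]. *)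
Inductive jet_poly : (jet R n -> R) -> Prop :=
| Jet_phase K : smooth_on S K -> jet_poly (on_jets K)
| Jet_coord k i : jet_poly (fun y => y k i 0)
| Jet_add F G : jet_poly F -> jet_poly G -> jet_poly (fun y => F y + G y)
| Jet_mul F G : jet_poly F -> jet_poly G -> jet_poly (fun y => F y * G y)
| Jet_eq F G : {in jets_over, F =1 G} -> jet_poly G -> jet_poly F.

Lemma jet_poly_cst (c : R) : jet_poly (fun=> c).
Proof.
apply: (@Jet_eq _ (on_jets (cst c))) => //.
by apply: Jet_phase; exact: smooth_on_cst.
Qed.

Lemma jet_polyZ (c : R) F : jet_poly F -> jet_poly (fun y => c * F y).
Proof. by move=> JF; apply: Jet_mul JF; exact: jet_poly_cst. Qed.

Lemma jet_poly_sum (I : Type) (r : seq I) (F : I -> jet R n -> R) :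
  (forall i, jet_poly (F i)) -> jet_poly (fun y => \sum_(i <- r) F i y).
Proof.
move=> JF; elim: r => [|i r IH].
  by apply: Jet_eq (jet_poly_cst 0) => y _; rewrite big_nil.
by apply: Jet_eq (Jet_add (JF i) IH) => y _; rewrite big_cons.
Qed.

Definition jet_line y (s : R) : jet R n := y + s *: (fun k => y k.+1).

Lemma jet_line0 y : jet_line y 0 = y.
Proof. by rewrite /jet_line scale0r addr0. Qed.

Lemma total_dt_lineE F y : total_dt F y = 'D_1 (F \o jet_line y) 0.
Proof. exact: derive1E. Qed.

(** What a phase function sees of [jet_line y]: a line in the normed space [phase], where the chain
    rule applies. *)
Let phase_line y (s : R) : phase R n := s *: (y 1%N, y 2%N) + (y 0%N, y 1%N).

Let on_jets_line K y : on_jets K \o jet_line y = K \o phase_line y.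
Proof.
by apply/funext => s; congr K; congr pair; exact: addrC.
Qed.

Let coord_line k i y : (fun y : jet R n => y k i 0) \o jet_line y =
  (fun s : R => s *: (y k.+1 i 0 : R) + y k i 0).
Proof.
apply/funext => s; rewrite -[LHS]/((y k + s *: y k.+1) i 0) !mxE.
exact: addrC.
Qed.

(** Takes the place of openness of [jets_over]: [total_dt] differentiates along [jet_line y] only,
    so no topology on jets is involved. *)
Lemma jets_over_near y : jets_over y ->
  \forall s \near (0 : R), jets_over (jet_line y s).
Proof.
move=> Sy; have cl : {for 0, continuous (phase_line y)}.
  apply/differentiable_continuous/derivable1_diffP.
  by case: (is_derive_line (y 1%N, y 2%N) (y 0%N, y 1%N) 0).
have : \forall s \near (0 : R), S (phase_line y s).
  by apply: cl; rewrite /phase_line scale0r add0r; exact: open_nbhs_nbhs.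
apply: filterS => s; rewrite /jets_over /=.
by congr S; congr pair; exact: addrC.
Qed.

Lemma total_dt_eq F G : {in jets_over, F =1 G} ->
  {in jets_over, total_dt F =1 total_dt G}.
Proof.
move=> FG y /set_mem Sy; rewrite !total_dt_lineE; apply: near_eq_derive.
by apply: filterS (jets_over_near Sy) => s Ss /=; apply: FG; rewrite inE.
Qed.

Lemma derivable_jet_poly F y : jet_poly F -> jets_over y ->
  derivable (F \o jet_line y) 0 1.
Proof.
move=> + Sy; elim=> {F} [K sK|k i|F G _ dF _ dG|F G _ dF _ dG|F G FG _ dG].
- rewrite on_jets_line.
  have dK : differentiable K (phase_line y 0).
    by rewrite /phase_line scale0r add0r; exact: smooth_on_diff sK Sy.
  by have [] := is_derive_curve (is_derive_line _ _ _) dK.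
- by rewrite coord_line; case: (is_derive_line (y k.+1 i 0 : R) (y k i 0) 0).
- exact: derivableD.
- exact: derivableM.
- apply: near_eq_derivable dG.
  by apply: filterS (jets_over_near Sy) => s Ss /=; rewrite FG// inE.
Qed.

Lemma total_dtD F G : jet_poly F -> jet_poly G ->
  {in jets_over, total_dt (fun y => F y + G y) =1
                 (fun y => total_dt F y + total_dt G y)}.
Proof.
move=> JF JG y /set_mem Sy; rewrite !total_dt_lineE.
exact: (deriveD (derivable_jet_poly JF Sy) (derivable_jet_poly JG Sy)).
Qed.

Lemma total_dtM F G : jet_poly F -> jet_poly G ->
  {in jets_over, total_dt (fun y => F y * G y) =1
                 (fun y => F y * total_dt G y + G y * total_dt F y)}.
Proof.
move=> JF JG y /set_mem Sy; rewrite !total_dt_lineE.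
rewrite (deriveM (derivable_jet_poly JF Sy) (derivable_jet_poly JG Sy)) /=.
by rewrite jet_line0.
Qed.

Lemma total_dt_on_jets K : smooth_on S K ->
  {in jets_over, total_dt (on_jets K) =1 (fun y =>
    \sum_i on_jets (partial_q i K) y * y 1%N i 0 +
    \sum_i on_jets (partial_v i K) y * y 2%N i 0)}.
Proof.
move=> sK y /set_mem Sy; rewrite total_dt_lineE on_jets_line.
have dK0 := smooth_on_diff sK Sy.
have dK : differentiable K (phase_line y 0) by rewrite /phase_line scale0r add0r.
have [_ ->] := is_derive_curve (is_derive_line _ _ _) dK.
rewrite /phase_line scale0r add0r derive_grad// /dotp.
by congr (_ + _); apply: eq_bigr => i _; rewrite mxE.
Qed.

Lemma total_dt_coord k i y : total_dt (fun y => y k i 0) y = y k.+1 i 0.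
Proof.
rewrite total_dt_lineE coord_line.
by case: (is_derive_line (y k.+1 i 0 : R) (y k i 0) 0).
Qed.

Lemma jet_poly_total_dt F : jet_poly F -> jet_poly (total_dt F).
Proof.
elim=> {F} [K sK|k i|F G JF JF' JG JG'|F G JF JF' JG JG'|F G FG JG JG'].
- apply: Jet_eq (total_dt_on_jets sK) _; apply: Jet_add; apply: jet_poly_sum => i.
    apply: Jet_mul; last exact: Jet_coord.
    by apply: Jet_phase; exact: smooth_on_derive.
  apply: Jet_mul; last exact: Jet_coord.
  by apply: Jet_phase; exact: smooth_on_derive.
- by apply: Jet_eq (Jet_coord k.+1 i) => y _; exact: total_dt_coord.
- by apply: Jet_eq (total_dtD JF JG) _; exact: Jet_add.
- by apply: Jet_eq (total_dtM JF JG) _; apply: Jet_add; exact: Jet_mul.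
- by apply: Jet_eq JG'; exact: total_dt_eq.
Qed.

Lemma jet_poly_iter_total_dt k F : jet_poly F -> jet_poly (iter k total_dt F).
Proof. by move=> JF; elim: k => //= k IH; exact: jet_poly_total_dt. Qed.

Lemma iter_total_dt_eq k F G : {in jets_over, F =1 G} ->
  {in jets_over, iter k total_dt F =1 iter k total_dt G}.
Proof. by move=> FG; elim: k => //= k IH; exact: total_dt_eq. Qed.

Lemma total_dtN F : jet_poly F ->
  {in jets_over, total_dt (fun y => - F y) =1 (fun y => - total_dt F y)}.
Proof.
move=> JF y /set_mem Sy; rewrite !total_dt_lineE.
exact: (deriveN (derivable_jet_poly JF Sy)).
Qed.

Lemma iter_total_dtB k F G : jet_poly F -> jet_poly G ->
  {in jets_over, iter k total_dt (fun y => F y - G y) =1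
    (fun y => iter k total_dt F y - iter k total_dt G y)}.
Proof.
move=> JF JG; elim: k => //= k IH y yS; rewrite (total_dt_eq IH)//.
have JFk := jet_poly_iter_total_dt k JF.
have JGk := jet_poly_iter_total_dt k JG.
have JNGk : jet_poly (fun y => - iter k total_dt G y).
  by apply: Jet_eq (jet_polyZ (-1) JGk) => z _; rewrite mulN1r.
by rewrite total_dtD// total_dtN.
Qed.

Lemma jet_poly_dotp (g : phase R n -> 'cV[R]_n) k : smooth_vec S g ->
  jet_poly (fun y => dotp (g (y 0%N, y 1%N)) (y k)).
Proof.
move=> sg; apply: jet_poly_sum => i; apply: Jet_mul; last exact: Jet_coord.
exact: (Jet_phase (sg i)).
Qed.

Lemma jet_poly_theta2 K : smooth_on S K -> jet_poly (theta2 K).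
Proof.
move=> sK; apply: Jet_add; apply: jet_polyZ; apply: jet_poly_dotp.
  exact: smooth_vec_grad_q.
exact: smooth_vec_grad_v.
Qed.

Section along.
Context L (sL : smooth_on S L) (L_regular : forall x, S x -> hess_vv L x \in unitmx).

Lemma reduce_EL_eq F G : {in jets_over, F =1 G} ->
  {in S, reduce_EL L F =1 reduce_EL L G}.
Proof.
move=> FG x /set_mem Sx; apply: FG; rewrite inE /jets_over /=.
by rewrite -surjective_pairing.
Qed.

(** [reduce_EL L] evaluates at a jet whose coordinates are smooth in [x], hence respects sums and
    products. *)
Lemma smooth_on_reduce_EL F : jet_poly F -> smooth_on S (reduce_EL L F).
Proof.
elim=> {F} [K sK|k i|F G _ sF _ sG|F G _ sF _ sG|F G FG _ sG].
- by apply: (smooth_on_eq S_open _ sK) => -[q v].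
- exact: smooth_vec_jet_along.
- exact: smooth_onD.
- exact: smooth_onM.
- exact: (smooth_on_eq S_open (reduce_EL_eq FG) sG).
Qed.

(** Needed because [Phi2 L L] is, up to sign, a coefficient of the surrogate, and [theta2] and
    [total_dt] are applied to it in turn. *)
Lemma smooth_on_Phi2 K : smooth_on S K -> smooth_on S (Phi2 L K).
Proof.
move=> sK; apply: smooth_on_reduce_EL; apply: Jet_add; first exact: jet_poly_theta2.
have J := jet_polyZ (- 24^-1) (jet_poly_iter_total_dt 2 (Jet_phase sK)).
by apply: Jet_eq J => y _; rewrite mulNr.
Qed.

End along.
End jets.

(** * Series constant in h *)

(** The recurrence for [m <= 4] is a triangular linear system; [B_1] and [B_3] occur as intermediate
    unknowns. *)
Lemma bernoulli_0_2_4 (R : realType) :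
  bernoulli 0 = 1 :> R /\ bernoulli 2 = 6^-1 :> R /\ bernoulli 4 = - 30^-1 :> R.
Proof.
have := bernoulli_sum R 0; have := bernoulli_sum R 1; have := bernoulli_sum R 2.
have := bernoulli_sum R 3; have := bernoulli_sum R 4.
rewrite !big_ord_recr !big_ord0 /=.
rewrite !bin0 !bin1 (_ : 'C(3, 2) = 3)// (_ : 'C(4, 2) = 6)// (_ : 'C(4, 3) = 4)//.
rewrite (_ : 'C(5, 2) = 10)// (_ : 'C(5, 3) = 10)// (_ : 'C(5, 4) = 5)//.
by move=> B4 B3 B2 B1 B0; repeat split; lra.
Qed.

Section constant_series.
Context {R : realType} {n : nat}.
Implicit Types (L : phase R n -> R) (f g : phase R n -> 'cV[R]_n) (x : phase R n).

Lemma hess_vv_cst0 x : hess_vv (fun=> 0 : R) x = 0.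
Proof.
apply/matrixP => i j; rewrite !mxE /partial_v (_ : 'D_(0, delta_mx j 0) _ = cst 0).
  exact: derive_cst.
by apply/funext => y; exact: derive_cst.
Qed.

Lemma grad_q_cst0 x : grad_q (fun=> 0 : R) x = 0.
Proof. by apply/matrixP => i j; rewrite !mxE; exact: derive_cst. Qed.

Lemma hess_qv_cst0 x : hess_qv (fun=> 0 : R) x = 0.
Proof.
apply/matrixP => i j; rewrite !mxE /partial_v /partial_q.
rewrite (_ : 'D_(delta_mx j 0, 0) _ = cst 0); first exact: derive_cst.
by apply/funext => y; exact: derive_cst.
Qed.

Lemma cst_seriesS (T : Type) (V : nmodType) (F : T -> V) i :
  cst_series F i.+1 = (fun=> 0).
Proof. by []. Qed.

Lemma EL_series_cst L : EL_series (cst_series L) = cst_series (EL_field L).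
Proof.
have inv x k : series_invmx (fun j => hess_vv (cst_series L j) x) k =
    if k == 0%N then invmx (hess_vv L x) else 0.
  elim/ltn_ind: k => k IH; rewrite series_invmxE; case: eqP => // k0.
  rewrite big1 ?mulmx0 ?oppr0// => i _.
  have : (0 < k - i)%N by rewrite subn_gt0.
  case: (k - i)%N => // m _.
  by rewrite cst_seriesS hess_vv_cst0 mul0mx.
apply/funext => -[|k]; apply/funext => x; rewrite /EL_series.
  by rewrite big_ord1 inv eqxx.
(* In a coefficient of positive index, the term [i = 0] meets a null coefficient of the Lagrangian,
   and every other term a null coefficient of the inverse series. *)
rewrite big1 // => -[[|i] ik] _; rewrite inv /=.
  by rewrite cst_seriesS grad_q_cst0 hess_qv_cst0 mul0mx subrr mulmx0.
exact: mul0mx.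
Qed.

Lemma dt_along_series_cst f g :
  dt_along_series (cst_series f) (cst_series g) = cst_series (dt_along f g).
Proof.
apply/funext => -[|m]; apply/funext => x; rewrite /dt_along_series.
  by rewrite big_ord1.
rewrite cst_seriesS [X in X + _]derive_cst add0r big1// => -[[|i] im] _ /=.
  exact: derive_cst.
exact: derive0.
Qed.

Lemma jet_along_series_cst f k :
  jet_along_series (cst_series f) k = cst_series (jet_along f k).
Proof.
case: k => [|[|k]] //=; elim: k => //= k ->; exact: dt_along_series_cst.
Qed.

(** The substituted formal jet is constant in [h], so of the Taylor coefficients of [F i] only that
    of order 0 survives, which forces [i = m]. *)
Lemma reduce_EL_series_cst L (F : nat -> jet R n -> R) m x :
  reduce_EL_series (cst_series L) F m x = reduce_EL L (F m) x.
Proof.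
rewrite /reduce_EL_series /series_comp big_ord_recr /= subnn taylor_coef0.
rewrite big1 ?add0r; last first.
  move=> i _; apply: taylor_coef_const; last by rewrite subn_gt0.
  move=> [//|l] _; apply/funext => k.
  by rewrite EL_series_cst jet_along_series_cst.
rewrite /reduce_EL; congr (F m); apply/funext => k.
by rewrite EL_series_cst jet_along_series_cst.
Qed.

End constant_series.

(** * Locality of the Euler--Lagrange series *)

Section locality.
Context {R : realType} {n : nat} (S : set (phase R n)) (S_open : open S).

(** The inverse series and the Cauchy product at index [m] only consult indices up to [m]. This
    transfers the estimate on Lagrangians to their Euler--Lagrange equations. *)
Lemma EL_series_eq_on (A B : nat -> phase R n -> R) m :
  (forall i, (i <= m)%N -> {in S, A i =1 B i}) ->
  {in S, EL_series A m =1 EL_series B m}.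
Proof.
move=> AB x xS; have /set_mem Sx := xS.
have pq i k : (i <= m)%N -> {in S, partial_q k (A i) =1 partial_q k (B i)}.
  by move=> im y /set_mem Sy; exact: derive_eq_on (AB _ im).
have pv i k : (i <= m)%N -> {in S, partial_v k (A i) =1 partial_v k (B i)}.
  by move=> im y /set_mem Sy; exact: derive_eq_on (AB _ im).
have hvv i : (i <= m)%N -> hess_vv (A i) x = hess_vv (B i) x.
  by move=> im; apply: eq_mx => k l; apply: (derive_eq_on S_open _ Sx); exact: pv.
have hqv i : (i <= m)%N -> hess_qv (A i) x = hess_qv (B i) x.
  by move=> im; apply: eq_mx => k l; apply: (derive_eq_on S_open _ Sx); exact: pq.
have gq i : (i <= m)%N -> grad_q (A i) x = grad_q (B i) x.
  by move=> im; apply: eq_mx => k l; exact: pq.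
apply: eq_bigr => i _; have mi : (m - i <= m)%N := leq_subr _ _.
apply: f_equal2.
  by apply: eq_series_invmx => j ji; apply: hvv; rewrite (leq_trans ji)// -ltnS.
exact (f_equal2 (fun u M => u - M *m x.2) (gq _ mi) (hqv _ mi)).
Qed.

End locality.

(** * Jet Lagrangian of the midpoint rule *)

Section midpoint.
Context {R : realType} {n : nat} (S : set (phase R n)) (S_open : open S).
Implicit Types (K L : phase R n -> R) (Lam : nat -> phase R n -> R) (y : jet R n).

Lemma midpoint_curve0 y : midpoint_curve y 0 = (y 0%N, y 1%N).
Proof. by rewrite /midpoint_curve muln0 expr0 mul1r fact0 invr1 !scale1r. Qed.

(** Here [8 = 2^2 2!] and [24 = 2^2 3!]; at the next order, [384 = 2^4 4!] and [1920 = 2^4 5!]. *)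
Lemma midpoint_curve1 y : midpoint_curve y 1 = (8^-1 *: y 2%N, 24^-1 *: y 3%N).
Proof.
rewrite /midpoint_curve /= (_ : 2`!%N = 2%N)// (_ : 3`!%N = 6%N)//.
by congr pair; congr (_ *: _); field.
Qed.

Lemma midpoint_curve2 y : midpoint_curve y 2 = (384^-1 *: y 4%N, 1920^-1 *: y 5%N).
Proof.
rewrite /midpoint_curve /= (_ : 4`!%N = 24%N)// (_ : 5`!%N = 120%N)//.
by congr pair; congr (_ *: _); field.
Qed.

Lemma midpoint_taylor1 K : smooth_on S K ->
  {in jets_over S, (fun y => taylor_coef K (midpoint_curve y) 1) =1 theta2 K}.
Proof.
move=> sK y /set_mem Sy.
have Sc : S (midpoint_curve y 0) by rewrite midpoint_curve0.
rewrite (taylor_coef1 sK Sc) midpoint_curve0 midpoint_curve1.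
by rewrite derive_grad ?dotpZr//; exact: smooth_on_diff sK Sy.
Qed.

Lemma midpoint_taylor2 K : smooth_on S K ->
  {in jets_over S, (fun y => taylor_coef K (midpoint_curve y) 2) =1 theta4 K}.
Proof.
move=> sK y /set_mem Sy.
have Sc : S (midpoint_curve y 0) by rewrite midpoint_curve0.
rewrite (taylor_coef2 S_open sK Sc) midpoint_curve0 midpoint_curve1 midpoint_curve2.
rewrite (derive2_hess S_open _ _ sK Sy) derive_grad; last exact: smooth_on_diff sK Sy.
(* The quadratic constants of [theta4] are [1/128 = (1/2)(1/8)^2], [1/1152 = (1/2)(1/24)^2] and
   [1/192 = (1/8)(1/24)], the last one doubled by the two mixed terms. *)
have C (u v a b c d : 'cV[R]_n) (A B M : 'M[R]_n) :
    dotp u (384^-1 *: a) + dotp v (1920^-1 *: b) +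
      2^-1 * (bilin (8^-1 *: c) A (8^-1 *: c) + bilin (24^-1 *: d) B (24^-1 *: d) +
        2 * bilin (24^-1 *: d) M (8^-1 *: c)) =
    384^-1 * dotp u a + 1920^-1 * dotp v b + 128^-1 * bilin c A c +
      1152^-1 * bilin d B d + 192^-1 * bilin d M c.
  by rewrite !dotpZr !bilinZ; field.
exact: C.
Qed.

Lemma midpoint_series0 Lam : midpoint_series Lam 0 = on_jets (Lam 0%N).
Proof.
apply/funext => y.
by rewrite /midpoint_series /series_comp big_ord1 taylor_coef0 midpoint_curve0.
Qed.

Lemma midpoint_series1 Lam : smooth_on S (Lam 0%N) ->
  {in jets_over S, midpoint_series Lam 1 =1
    (fun y => theta2 (Lam 0%N) y + on_jets (Lam 1%N) y)}.
Proof.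
move=> s0 y yS; rewrite /midpoint_series /series_comp !big_ord_recr big_ord0 /=.
by rewrite add0r subnn subn0 taylor_coef0 midpoint_curve0 (midpoint_taylor1 s0 yS).
Qed.

Lemma midpoint_series2 Lam : smooth_on S (Lam 0%N) -> smooth_on S (Lam 1%N) ->
  {in jets_over S, midpoint_series Lam 2 =1
    (fun y => theta4 (Lam 0%N) y + theta2 (Lam 1%N) y + on_jets (Lam 2%N) y)}.
Proof.
move=> s0 s1 y yS; rewrite /midpoint_series /series_comp !big_ord_recr big_ord0 /=.
rewrite add0r subnn subn0 taylor_coef0 midpoint_curve0.
by rewrite (midpoint_taylor2 s0 yS) (midpoint_taylor1 s1 yS).
Qed.

Lemma jet_lagrangian1 Lam y : jet_lagrangian Lam 1 y =
  midpoint_series Lam 1 y - 24^-1 * iter 2 total_dt (midpoint_series Lam 0) y.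
Proof.
have [B0 [B2 _]] := bernoulli_0_2_4 R.
rewrite /jet_lagrangian !big_ord_recr big_ord0 /= add0r muln0 muln1 B0 B2.
rewrite (_ : 2`!%N = 2%N)// subnn subn0 fact0 expr0 divr1.
(* [(1/2 - 1) B_2 / 2! = - 1/24]. *)
have C (a b : R) : (2 - 1) * (1 / 1%:R) * a + (2 / 2 ^+ 2 - 1) * (6^-1 / 2) * b =
  a - 24^-1 * b by field.
exact: C.
Qed.

Lemma jet_lagrangian2 Lam y : jet_lagrangian Lam 2 y =
  midpoint_series Lam 2 y - 24^-1 * iter 2 total_dt (midpoint_series Lam 1) y +
  7 / 5760 * iter 4 total_dt (midpoint_series Lam 0) y.
Proof.
have [B0 [B2 B4]] := bernoulli_0_2_4 R.
rewrite /jet_lagrangian !big_ord_recr big_ord0 /= add0r muln0 muln1.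
rewrite (_ : 2 * 2 = 4)%N// B0 B2 B4.
rewrite (_ : 2`!%N = 2%N)// (_ : 4`!%N = 24%N)// subnn subn0 fact0 expr0 divr1.
(* [(1/8 - 1) B_4 / 4! = (7/8)(1/30)(1/24) = 7/5760]. *)
have C (a b c : R) : (2 - 1) * (1 / 1%:R) * a + (2 / 2 ^+ 2 - 1) * (6^-1 / 2) * b +
  (2 / 2 ^+ 4 - 1) * (- 30^-1 / 24) * c = a - 24^-1 * b + 7 / 5760 * c by field.
exact: C.
Qed.

End midpoint.

(** * Cancellation in the jet Lagrangian of the surrogate *)

Section surrogate.
Context {R : realType} {n : nat} (S : set (phase R n)) (S_open : open S).
Context (L : phase R n -> R) (sL : smooth_on S L)
  (L_regular : forall x, S x -> hess_vv L x \in unitmx).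

Lemma theta2N (K : phase R n -> R) : smooth_on S K ->
  {in jets_over S, theta2 (fun x => - K x) =1 (fun y => - theta2 K y)}.
Proof.
move=> sK y /set_mem Sy; have dK := smooth_on_diff sK Sy.
have gq : grad_q (fun x => - K x) (y 0%N, y 1%N) = - grad_q K (y 0%N, y 1%N).
  apply/matrixP => i j; rewrite !mxE.
  by apply: deriveN; exact: diff_derivable.
have gv : grad_v (fun x => - K x) (y 0%N, y 1%N) = - grad_v K (y 0%N, y 1%N).
  apply/matrixP => i j; rewrite !mxE.
  by apply: deriveN; exact: diff_derivable.
have C (u v a b : 'cV[R]_n) : 8^-1 * dotp (- u) a + 24^-1 * dotp (- v) b =
    - (8^-1 * dotp u a + 24^-1 * dotp v b) by rewrite !dotpNl; ring.
rewrite /theta2 gq gv; exact: C.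
Qed.

Lemma reduce_jet_lagrangian_surrogate4 m : (m < 3)%N ->
  {in S, reduce_EL L (jet_lagrangian (surrogate4 L) m) =1 cst_series L m}.
Proof.
have sK := smooth_on_Phi2 S_open sL L_regular sL.
set K := Phi2 L L in sK.
have sNK : smooth_on S (surrogate4 L 1) by exact: smooth_onN.
move=> m3 x xS; have /set_mem Sx := xS.
(* [y] is the jet at [x] of the solution of the Euler--Lagrange equation of [L]; all the terms below
   are compared at this single jet. *)
rewrite /reduce_EL; set y := fun k => _.
have Ey : (y 0%N, y 1%N) = x by rewrite -surjective_pairing.
have yS : y \in jets_over S by rewrite inE /jets_over /= Ey.
case: m m3 => [|[|[|//]]] _.
- by rewrite jet_lagrangian0 /on_jets Ey.
- rewrite jet_lagrangian1 midpoint_series0 (@midpoint_series1 _ _ S)//.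
  rewrite /on_jets -/(on_jets _) Ey /surrogate4 /Phi2 /reduce_EL -/y.
  have C (a b : R) : a + - (a - b) - b = 0 by ring.
  exact: C.
- rewrite jet_lagrangian2 midpoint_series0 (@midpoint_series2 _ _ S)//.
  have J2 := jet_poly_theta2 S_open sL.
  (* Equality at [y] alone would not do: the total derivatives are taken on free jets, before the
     reduction, so the identity must hold on the whole of [jets_over S]. *)
  have E1 : {in jets_over S, midpoint_series (surrogate4 L) 1 =1
      (fun y => theta2 L y - on_jets K y)}.
    by move=> z zS; rewrite (@midpoint_series1 _ _ S).
  rewrite (iter_total_dt_eq S_open 2 E1 yS).
  rewrite (iter_total_dtB S_open 2 J2 (Jet_phase sK) yS).
  rewrite (theta2N sK yS).
  have -> : on_jets (surrogate4 L 2) y = surrogate4 L 2 x by rewrite -Ey.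
  rewrite /surrogate4 /Phi4 /reduce_EL -/y.
  have -> : Phi2 L K x = theta2 K y - 24^-1 * iter 2 total_dt (on_jets K) y by [].
  (* At [y], these are [theta4(L)], [L''''], [theta2(K)], [K''] and [theta2(L)'']. The term
     [Phi2(K)] of the surrogate absorbs [t2] and [k], and its last term absorbs [d]. *)
  have C (t4 d4 t2 k d : R) : t4 + - t2 + (- (t4 + 7 / 5760 * d4) + (t2 - 24^-1 * k) +
    24^-1 * d) - 24^-1 * (d - k) + 7 / 5760 * d4 = 0 by ring.
  exact: C.
Qed.

End surrogate.

Theorem mainTheorem2 (R : realType) (n : nat) (U : set 'cV[R]_n)
    (L : phase R n -> R) (Lhat_m : nat -> phase R n -> R)
    (U_open : open U)
    (L_smooth : smooth_on (U `*` setT) L)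
    (L_regular : forall x, (U `*` setT) x -> hess_vv L x \in unitmx)
    (Lhat_m_modified : modified_lagrangian (U `*` setT) (surrogate4 L) Lhat_m) :
  eq_bigO_h (U `*` setT) 6 Lhat_m (cst_series L) /\
  eq_bigO_h (U `*` setT) 6 (EL_series Lhat_m) (cst_series (EL_field L)).
Proof.
have S_open : open (U `*` [set: 'cV[R]_n]).
  rewrite openE => -[q v] [/= Uq _].
  exists (U, setT) => //=; split; last exact: filterT.
  exact: open_nbhs_nbhs.
have Lhat_mE m x : (m < 3)%N -> (U `*` setT) x -> Lhat_m m x = cst_series L m x.
  elim/ltn_ind: m x => m IH x m3 Sx.
  rewrite (Lhat_m_modified m x Sx).
  (* The right-hand side at index [m] consults [Lhat_m] strictly below [m], where the induction
     hypothesis identifies it with the constant series. *)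
  rewrite (@reduce_EL_series_local _ _ _ Lhat_m (cst_series L) m S_open _ _ x Sx).
    rewrite reduce_EL_series_cst.
    by rewrite (reduce_jet_lagrangian_surrogate4 S_open L_smooth L_regular m3) ?inE.
  by move=> i y im Sy; apply: IH => //; exact: ltn_trans m3.
split=> m x m6 Sx; have m3 : (m < 3)%N by rewrite -(ltn_pmul2l (isT : 0 < 2)%N).
  exact: Lhat_mE.
rewrite (@EL_series_eq_on _ _ _ S_open Lhat_m (cst_series L)) ?inE//.
  by rewrite EL_series_cst.
by move=> i im y /set_mem Sy; apply: Lhat_mE => //; exact: leq_ltn_trans m3.
Qed.
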